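(* Let $k$ be a positive integer and let $n\geq 34k^3$. If $G$ is a connected graph with $n$ vertices and at most $n\left(1+\frac{1}{119k^2+62k}\right)$ edges, then $r(G,B_k)=2n-1$.
   Context: For graphs $G,H$, the Ramsey number $r(G,H)$ is the smallest positive integer $N$ such that every red-blue coloring of the edges of the complete graph $K_N$ contains a red subgraph isomorphic to $G$ or a blue subgraph isomorphic to $H$. The book $B_k$ is the graph $K_2+\overline{K}_k$ on $k+2$ vertices, i.e. an edge together with $k$ further vertices each adjacent to both endpoints of that edge (equivalently $k$ triangles sharing a common edge). All graphs are finite and simple. *)

(* Defs.v *)
From mathcomp Require Import all_boot all_order all_algebra.

Set Implicit Arguments.
Unset Strict Implicit.
Unset Printing Implicit Defensive.

Record sgraph := SGraph {
  svertex :> finType;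
  sedge : rel svertex;
  sedge_sym : symmetric sedge;
  sedge_irr : irreflexive sedge
}.
Arguments sedge {s} x y.

Definition edge_set (G : sgraph) : {set {set G}} :=
  [set e : {set G} | [exists x : G, exists y : G, sedge x y && (e == [set x; y])]].

Definition connected_graph (G : sgraph) : Prop :=
  0 < #|G| /\ forall x y : G, connect (@sedge G) x y.

(* [contains_copy H G]: H has a subgraph isomorphic to G. Subgraphs are not required to be induced: edges must be mapped to edges, but
   non-edges are unconstrained. *)
Definition contains_copy (H G : sgraph) : Prop :=
  exists f : G -> H, injective f /\ (forall x y : G, sedge x y -> sedge (f x) (f y)).

Section Complete.
Variable n : nat.
Definition complete_rel (x y : 'I_n) : bool := x != y.
Lemma complete_rel_sym : symmetric complete_rel.
Proof. by move=> x y; rewrite /complete_rel eq_sym. Qed.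
Lemma complete_rel_irr : irreflexive complete_rel.
Proof. by move=> x; rewrite /complete_rel eqxx. Qed.
Definition complete_graph : sgraph := SGraph complete_rel_sym complete_rel_irr.
End Complete.

Section Complement.
Variable G : sgraph.
Definition compl_rel (x y : G) : bool := (x != y) && ~~ sedge x y.
Lemma compl_rel_sym : symmetric compl_rel.
Proof. by move=> x y; rewrite /compl_rel eq_sym sedge_sym. Qed.
Lemma compl_rel_irr : irreflexive compl_rel.
Proof. by move=> x; rewrite /compl_rel eqxx. Qed.
Definition compl_graph : sgraph := SGraph compl_rel_sym compl_rel_irr.
End Complement.

(* The join G + H: the disjoint union together with all edges between G and H. *)
Section Join.
Variables G H : sgraph.
Definition join_rel (u v : G + H) : bool :=
  match u, v with
  | inl x, inl y => sedge x y
  | inr x, inr y => sedge x y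
  | _, _ => true
  end.
Lemma join_rel_sym : symmetric join_rel.
Proof. by move=> [x|x] [y|y] //=; rewrite sedge_sym. Qed.
Lemma join_rel_irr : irreflexive join_rel.
Proof. by move=> [x|x] /=; rewrite sedge_irr. Qed.
Definition join_graph : sgraph := SGraph join_rel_sym join_rel_irr.
End Join.

Definition book (k : nat) : sgraph :=
  join_graph (complete_graph 2) (compl_graph (complete_graph k)).

(* A 2-colouring of the edges of K_N is a function c on sets of vertices, true
   standing for red and false for blue. Only its values on the edges of K_N,
   i.e. on the pairs [set x; y] with x != y, are ever used. *)
Section ColourClass.
Variables (N : nat) (c : {set 'I_N} -> bool) (b : bool).
Definition colour_rel (x y : complete_graph N) : bool :=
  sedge x y && (c [set x; y] == b).
Lemma colour_rel_sym : symmetric colour_rel.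
Proof. by move=> x y; rewrite /colour_rel sedge_sym setUC. Qed.
Lemma colour_rel_irr : irreflexive colour_rel.
Proof. by move=> x; rewrite /colour_rel sedge_irr. Qed.
Definition colour_class : sgraph := SGraph colour_rel_sym colour_rel_irr.
End ColourClass.

Definition arrows (N : nat) (G H : sgraph) : Prop :=
  forall c : {set 'I_N} -> bool,
    contains_copy (colour_class c true) G \/ contains_copy (colour_class c false) H.

(* [is_ramsey_number G H N] states r(G, H) = N, including the existence of the
   minimum. *)
Definition is_ramsey_number (G H : sgraph) (N : nat) : Prop :=
  [/\ 0 < N, arrows N G H & forall M, 0 < M -> arrows M G H -> N <= M].

Lemma is_ramsey_number_uniq (G H : sgraph) (M N : nat) :
  is_ramsey_number G H M -> is_ramsey_number G H N -> M = N.
Proof.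
move=> [M0 aM minM] [N0 aN minN]; apply/eqP.
by rewrite eqn_leq (minM _ N0 aN) (minN _ M0 aM).
Qed.

Lemma card_book (k : nat) : #|book k| = k + 2.
Proof. by rewrite card_sum !card_ord addnC. Qed.

(* Main.v *)
Require Import Defs.
From mathcomp Require Import all_boot all_order all_algebra.
From mathcomp Require Import zify.

(* Fix a colouring of K_(2n-1) without blue B_k. If the blue neighbourhood of
   some vertex has at least n vertices, the red graph on it misses fewer than k
   edges at each vertex; otherwise every red degree is at least n - 1. The guest
   is embedded by induction on its size, using three facts.

   (1) A path of 3k + 3 vertices of degree two may be shortened by one vertex.
   Given an embedding of the shortened guest, either the image of the path can
   be rerouted in red through an outside vertex, or each outside vertex has at
   most k + 1 red neighbours on the path (otherwise there is a blue K_(k+2)).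
   In the latter case two outside vertices joined in blue would have k common
   blue neighbours on the path, so the outside is a red clique large enough for
   the whole guest.

   (2) Without such paths, a connected guest with m vertices, at most m + l edges
   and p leaves has m = O(k (p + l)), and it is O(sqrt l)-degenerate.

   (3) If all red degrees are at least n - 1, leaves can be removed and added
   back greedily, and by (2) a guest without leaves is small enough for a greedy
   embedding. Otherwise work in a set A of n blue neighbours of a vertex. The
   guest minus its leaves fits greedily into A, because there are many leaves.
   If some vertex has k - 1 leaves, it is sent to a vertex of A having no blue
   neighbour in A or many red neighbours outside A, and k - 1 of its leaves are
   placed last. If there is no such vertex, the leaves are placed one by one in
   A, exchanging two of them when necessary. *)

Set Implicit Arguments.
Unset Strict Implicit.
Unset Printing Implicit Defensive.

(** * Degree sums, connectivity and degeneracy of sparse guests *)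

Section Guest.
Variables (T : finType) (e : rel T).
Hypotheses (e_sym : symmetric e) (e_irr : irreflexive e).
Implicit Types (D S : {set T}) (u v : T).

(** Guests are vertex sets [D] inside a fixed type, so vertices can be removed without changing the
    type. [deg] is also applied to the blue relation, to count blue neighbours inside a set of host
    vertices. *)
Definition deg D u := #|[set v in D | e u v]|.
Definition degsum D := \sum_(u in D) deg D u.
(** Connectivity in terms of cuts: it passes more easily than walks do to a guest with a leaf
    removed or a path shortened. *)
Definition connected_on D := forall S, S \subset D -> S != set0 -> S != D ->
  exists u v, [/\ u \in S, v \in D :\: S & e u v].

Lemma deg_mono S D u : S \subset D -> deg S u <= deg D u.
Proof.
move=> sSD; apply/subset_leq_card/subsetP=> v; rewrite !inE => /andP[vS ->].
by rewrite (subsetP sSD).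
Qed.

Lemma degU1 S u v : u \notin S -> deg (u |: S) v = e v u + deg S v.
Proof.
move=> uS; rewrite /deg; case evu: (e v u).
  rewrite (_ : [set w in u |: S | e v w] = u |: [set w in S | e v w]).
    by rewrite cardsU1 inE (negPf uS) /= add1n.
  by apply/setP=> w; rewrite !inE; case: eqP => // ->; rewrite evu.
rewrite add0n; apply: eq_card => w; rewrite !inE.
by case: eqP => // ->; rewrite evu !andbF.
Qed.

Lemma degsumU1 S u : u \notin S -> degsum (u |: S) = degsum S + 2 * deg S u.
Proof.
move=> uS; rewrite /degsum big_setU1 //= degU1 // e_irr add0n.
rewrite (eq_bigr (fun v => e v u + deg S v)); last by move=> v _; rewrite degU1.
rewrite big_split /=.
have -> : \sum_(v in S) (e v u : nat) = deg S u.
  transitivity (\sum_(v in S | e u v) 1).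
    by rewrite big_mkcondr /=; apply: eq_bigr => v _; rewrite e_sym; case: (e u v).
  by rewrite sum1_card; apply: eq_card => v; rewrite !inE unfold_in.
by lia.
Qed.

Lemma degsumD1 D u : u \in D -> degsum D = degsum (D :\ u) + 2 * deg D u.
Proof.
move=> uD; have uS : u \notin D :\ u by rewrite setD11.
rewrite -{1}(setD1K uD) degsumU1 //; congr (_ + 2 * _).
by rewrite -[in RHS](setD1K uD) degU1 // e_irr.
Qed.

(* Growing [S] to [D] one adjacent vertex at a time adds at least one edge per
   vertex, so the excess of edges over vertices does not decrease. *)
Lemma degsum_sub D S l : connected_on D -> degsum D <= 2 * #|D| + 2 * l ->
  S \subset D -> S != set0 -> degsum S <= 2 * #|S| + 2 * l.
Proof.
move=> cD hD.
have [j] := ubnP (#|D| - #|S|).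
elim: j S => // j IH S hj sSD S0.
have [->//|nSD] := eqVneq S D.
have [u [v [uS /setDP[vD vS] euv]]] := cD S sSD S0 nSD.
have pr : #|S| < #|D| by apply: proper_card; rewrite properEneq nSD.
have sv : v |: S \subset D by rewrite subUset sub1set vD.
have cv : #|v |: S| = #|S|.+1 by rewrite cardsU1 vS.
have := IH (v |: S); rewrite cv degsumU1 // => H.
have {}H : degsum S + 2 * deg S v <= 2 * #|S|.+1 + 2 * l.
  by apply: H => //; [lia | apply/set0Pn; exists v; rewrite !inE eqxx].
suff : 0 < deg S v by lia.
by rewrite card_gt0; apply/set0Pn; exists u; rewrite inE uS e_sym.
Qed.

Lemma deg_lt S u : u \in S -> deg S u < #|S|.
Proof.
move=> uS; rewrite (cardsD1 u S) uS add1n ltnS; apply/subset_leq_card/subsetP=> v.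
by rewrite !inE => /andP[-> ev]; rewrite andbT; apply: contraTneq ev => ->; rewrite e_irr.
Qed.

Lemma min_deg S : S != set0 -> exists2 u, u \in S & deg S u * #|S| <= degsum S.
Proof.
case/set0Pn=> u0 u0S; case: (arg_minnP (deg S) u0S) => u uS hu; exists u => //.
by rewrite mulnC -sum_nat_const; apply: leq_sum => v /hu.
Qed.

(** A vertex of minimum degree in [S] works. If that degree exceeded [d], then [S] would have at
    least [d + 2] vertices and [(d + 1) * #|S| <= 2 * #|S| + 2 * l], whence
    [(d - 1) * (d + 2) <= 2 * l]. *)
Lemma degenerate D S l d : connected_on D -> degsum D <= 2 * #|D| + 2 * l ->
  2 * l < d.-1 * d.+2 -> S \subset D -> S != set0 ->
  exists u, [/\ u \in S, deg S u <= d & deg S u * #|S| <= 2 * #|S| + 2 * l].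
Proof.
move=> cD hD hd sSD S0; have [u uS hu] := min_deg S0.
have hS := degsum_sub cD hD sSD S0.
exists u; split=> //; last exact: leq_trans hu hS.
rewrite leqNgt; apply/negP=> du; have := deg_lt uS => lt.
have : d.+1 * #|S| <= 2 * #|S| + 2 * l.
  by apply: leq_trans hS; apply: leq_trans hu; rewrite leq_mul2r du orbT.
have : d.-1 * d.+2 <= d.-1 * #|S| by rewrite leq_mul2l; apply/orP; right; lia.
have : d.+1 * #|S| = d.-1 * #|S| + 2 * #|S|.
  by rewrite -mulnDl; case: d hd {du} => [|d] hd; [lia | congr (_ * _); lia].
by lia.
Qed.

(** Add the leaf to [S] exactly when its neighbour [h] lies in [S]; the edge leaving the resulting
    set then avoids the leaf. *)
Lemma connected_on_remove_leaf D u : connected_on D -> u \in D -> deg D u = 1 ->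
  connected_on (D :\ u).
Proof.
move=> cD uD /eqP/cards1P[h hE] S sS S0 SnD.
have eu v : v \in D -> e u v -> v = h.
  by move=> vD euv; apply/set1P; rewrite -hE inE vD.
have hD : h \in D by have := set11 h; rewrite -hE inE => /andP[].
have uS : u \notin S by apply: contraTN sS => uS; apply/subsetPn; exists u; rewrite ?setD11.
have sSD : S \subset D by apply: subset_trans sS (subsetDl _ _).
have [hS|hS] := boolP (h \in S).
  have [] := cD (u |: S).
  - by rewrite subUset sub1set uD.
  - by apply/set0Pn; exists u; rewrite !inE eqxx.
  - by apply: contraNneq SnD => <-; rewrite setU1K.
  move=> a [b [aS /setDP[bD bS] eab]]; exists a, b.
  move: aS bS; rewrite !inE negb_or => aS /andP[bu bS].
  case/orP: aS => [/eqP aE|aS]; last by split=> //; rewrite bu bS bD.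
  by move: bS; rewrite (eu b) ?hS // -aE.
have [] := cD S sSD S0.
  by apply: contraNneq uS => ->.
move=> a [b [aS /setDP[bD bS] eab]]; exists a, b; split=> //; rewrite !inE bS bD andbT.
apply: contraNneq hS => bE; rewrite -(eu a) //; first exact: (subsetP sSD).
by rewrite e_sym -bE.
Qed.

End Guest.

(** * Replacing a path [x y z] through a vertex of degree two by an edge *)

Section Shorten.
Variables (T : finType) (e : rel T).
Hypotheses (e_sym : symmetric e) (e_irr : irreflexive e).
Implicit Types (D S : {set T}).

Definition add_edge (x z : T) : rel T :=
  fun u v => [|| e u v, (u == x) && (v == z) | (u == z) && (v == x)].

Lemma add_edge_sym x z : symmetric (add_edge x z).
Proof. by move=> u v; rewrite /add_edge e_sym orbC [in RHS]orbC; congr (_ || _); rewrite orbC ![(v == _) && _]andbC. Qed.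

Lemma add_edge_irr x z : x != z -> irreflexive (add_edge x z).
Proof. by move=> xz u; rewrite /add_edge e_irr /=; case: eqP => [->|] /=; rewrite ?(negPf xz) // andbF. Qed.

Variables (D : {set T}) (x y z : T).
Hypotheses (xD : x \in D) (yD : y \in D) (zD : z \in D) (xz : x != z).
Hypotheses (yE : forall v, v \in D -> e y v = (v == x) || (v == z)).

Let eyx : e y x. Proof. by rewrite yE ?eqxx. Qed.
Let eyz : e y z. Proof. by rewrite yE ?eqxx ?orbT. Qed.
Let xy : x != y. Proof. by apply: contraTneq eyx => ->; rewrite e_irr. Qed.
Let zy : z != y. Proof. by apply: contraTneq eyz => ->; rewrite e_irr. Qed.

(** Removing [y] destroys two edges and [x z] restores at most one, so edges minus vertices does not
    grow. Equality fails when [x] and [z] are already adjacent. *)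
Lemma degsum_shorten : degsum (add_edge x z) (D :\ y) + 2 <= degsum e D.
Proof.
have d2 : deg e D y = 2.
  rewrite /deg (_ : [set _ in _ | _] = [set x; z]) ?cards2 ?xz //.
  apply/setP=> v; rewrite !inE; have [vD|vD] /= := boolP (v \in D); first exact: yE.
  by apply/esym/norP; split; apply: contraNneq vD => ->.
rewrite (degsumD1 e_sym e_irr yD) d2.
suff : degsum (add_edge x z) (D :\ y) <= degsum e (D :\ y) + 2 by lia.
have one a : \sum_(u in D :\ y) (u == a : nat) <= 1.
  have [aS|aS] := boolP (a \in D :\ y).
    by rewrite (bigD1 a) //= eqxx big1 // => u /andP[_ /negPf ->].
  by rewrite big1 // => u uS; case: eqP => // ua; rewrite ua (negPf aS) in uS.
apply: (@leq_trans (\sum_(u in D :\ y) (deg e (D :\ y) u + ((u == x) + (u == z))))); last first.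
  by rewrite !big_split /= leq_add2l (leq_add (one x) (one z)).
apply: leq_sum => u _; rewrite /deg /add_edge.
set A := [set v in D :\ y | e u v].
have sub : [set v in D :\ y | [|| e u v, (u == x) && (v == z) | (u == z) && (v == x)]]
    \subset A :|: ((if u == x then [set z] else set0) :|: (if u == z then [set x] else set0)).
  apply/subsetP=> v; rewrite !inE => /andP[-> /=]; case/or3P=> [->//|/andP[-> /eqP->]|/andP[-> /eqP->]];
  by rewrite !inE eqxx !orbT.
apply: leq_trans (subset_leq_card sub) _.
apply: leq_trans (leq_card_setU _ _) _; rewrite leq_add2l.
apply: leq_trans (leq_card_setU _ _) _.
by case: (u == x); case: (u == z); rewrite ?cards1 ?cards0.
Qed.

(** If [S] separates [x] from [z], the new edge leaves it. If it contains both, apply connectivity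
    to [S] with [y] added; if neither, no edge of [D] goes from [S] to [y]. *)
Lemma connected_on_shorten : connected_on e D -> connected_on (add_edge x z) (D :\ y).
Proof.
move=> cD S sS S0 SnD.
have yS : y \notin S by apply: contraTN sS => yS; apply/subsetPn; exists y; rewrite ?setD11.
have sSD : S \subset D by apply: subset_trans sS (subsetDl _ _).
have exz : add_edge x z x z by rewrite /add_edge !eqxx orbT.
have ezx : add_edge x z z x by rewrite /add_edge !eqxx !orbT.
have [xS|xS] := boolP (x \in S); have [zS|zS] := boolP (z \in S).
- have [] := cD (y |: S).
  + by rewrite subUset sub1set yD.
  + by apply/set0Pn; exists y; rewrite !inE eqxx.
  + by apply: contraNneq SnD => <-; rewrite setU1K.
  move=> a [b [aS /setDP[bD bS] eab]]; exists a, b.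
  move: aS bS; rewrite !inE negb_or => aS /andP[bu bS].
  case/orP: aS => [/eqP aE|aS]; last by split; rewrite // ?bu ?bS ?bD // /add_edge eab.
  by move: eab; rewrite aE yE // => /orP[]/eqP bE; rewrite bE ?xS ?zS in bS.
- by exists x, z; rewrite !inE zS zy zD.
- by exists z, x; rewrite !inE xS xy xD.
have [] := cD S sSD S0.
  by apply: contraNneq yS => ->.
move=> a [b [aS /setDP[bD bS] eab]]; exists a, b.
split; rewrite ?inE ?bS ?bD ?andbT //= /add_edge ?eab //.
apply: contraNneq xS => by_; move: eab; rewrite by_ e_sym yE ?(subsetP sSD) //.
by case/orP=> /eqP aE; rewrite -aE // in zS *; rewrite aS in zS.
Qed.

End Shorten.

(** * Greedy extension of partial embeddings *)

Lemma card_bigcup_leq (I T : finType) (P : pred I) (F : I -> {set T}) :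
  #|\bigcup_(i | P i) F i| <= \sum_(i | P i) #|F i|.
Proof.
elim/big_rec2: _ => [|i m A _ h]; first by rewrite cards0.
by apply: leq_trans (leq_card_setU _ _) _; rewrite leq_add2l.
Qed.

Section Embedding.
Variables (R : sgraph) (T : finType) (e : rel T).
Hypotheses (e_sym : symmetric e) (e_irr : irreflexive e).
Implicit Types (D S : {set T}) (A : {set R}) (u v : T) (f : T -> R).

(** The map is total and only its values on [S] matter, so extending an embedding is a pointwise
    update. *)
Definition partial_emb S f :=
  {in S &, injective f} /\ {in S &, forall u v, e u v -> sedge (f u) (f v)}.

Lemma partial_emb_sub S D f : S \subset D -> partial_emb D f -> partial_emb S f.
Proof.
move=> /subsetP sSD [fi fe]; split=> u v uS vS; first by apply: fi; apply: sSD.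
by apply: fe; apply: sSD.
Qed.

Lemma partial_emb_extend S f u y : partial_emb S f -> u \notin S ->
  y \notin f @: S -> (forall w, w \in S -> e u w -> sedge (f w) y) ->
  partial_emb (u |: S) [eta f with u |-> y].
Proof.
move=> [fi fe] uS yS hy.
have nu v : v \in S -> (v == u) = false by move=> vS; apply: contraNF uS => /eqP <-.
have ny v : v \in S -> f v <> y by move=> vS fv; rewrite -fv imset_f in yS.
split=> v w; rewrite !inE /= => /predU1P[->|vS] /predU1P[->|wS]; rewrite ?eqxx ?(nu v) ?(nu w) //.
- by move/esym/(ny w wS).
- by move/(ny v vS).
- exact: fi.
- by rewrite e_irr.
- by rewrite sedge_sym; apply: hy.
- by rewrite e_sym; apply: hy.
- exact: fe.
Qed.

(** Each placed neighbour of [u] excludes at most [c] vertices of [A], namely its blue neighbours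
    there; the used vertices are excluded as well, and some vertex remains. *)
Lemma free_vertex S f u A c :
  (forall w, w \in S -> e u w -> deg (@compl_rel R) A (f w) <= c) ->
  #|A :&: f @: S| + deg e S u * c < #|A| ->
  exists y, [/\ y \in A, y \notin f @: S & forall w, w \in S -> e u w -> sedge (f w) y].
Proof.
move=> hc hA.
pose B := \bigcup_(w in [set w in S | e u w]) [set y in A | compl_rel (f w) y].
have cB : #|B| <= deg e S u * c.
  rewrite /deg -sum_nat_const; apply: leq_trans (card_bigcup_leq _ _) _.
  by apply: leq_sum => w; rewrite inE => /andP[wS ew]; apply: hc.
have : 0 < #|A :\: (f @: S :|: B)|.
  have := cardsID (f @: S :|: B) A; rewrite setIUr.
  have := (leq_card_setU (A :&: f @: S) (A :&: B)).1.
  have : #|A :&: B| <= #|B| by apply/subset_leq_card/subsetIr.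
  by move: cB hA; lia.
case/card_gt0P => y; rewrite !inE negb_or => /andP[/andP[yS yB] yA].
exists y; split=> // w wS ew.
apply: contraNT yB => nr; apply/bigcupP; exists w; rewrite !inE ?wS // yA /compl_rel nr andbT /=.
by apply: contraNneq yS => <-; rewrite imset_f.
Qed.

(** A vertex of degree at most [d] is placed last, after the rest has been embedded by induction.
    The prescribed part [S0] is never removed, so [f0] survives on it. *)
Lemma greedy_embedding A S0 D f0 d c :
  S0 \subset D -> partial_emb S0 f0 -> f0 @: S0 \subset A ->
  (forall x, x \in A -> deg (@compl_rel R) A x <= c) ->
  (forall S, S0 \subset S -> S \subset D -> S != S0 ->
     exists2 u, u \in S :\: S0 & deg e S u <= d) ->
  #|D| + d * c <= #|A| ->
  exists f, [/\ partial_emb D f, f @: D \subset A & {in S0, f =1 f0}].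
Proof.
move=> sD emb0 im0 hA hd hcard.
have [j] := ubnP #|D|.
elim: j D sD hd hcard => // j IH D sD hd hcard hj.
have [<-|nD] := eqVneq S0 D; first by exists f0; split.
have [|u] := hd D sD (subxx _); first by rewrite eq_sym.
rewrite inE => /andP[uS0 uD] du.
have cD : #|D| = #|D :\ u|.+1 by rewrite (cardsD1 u D) uD.
have [|S sS SD nS|||f [emb im f0E]] := IH (D :\ u).
- by rewrite subsetD1 sD.
- by apply: hd => //; apply: subset_trans SD (subsetDl _ _).
- by move: hcard; lia.
- by move: hj; lia.
have dS : deg e (D :\ u) u <= d by apply: leq_trans du; apply: deg_mono (subsetDl _ _).
have [w wD ew|//|y [yA yf hy]] := @free_vertex (D :\ u) f u A c.
- by apply: hA; apply: (subsetP im); rewrite imset_f.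
- have : #|A :&: f @: (D :\ u)| <= #|D :\ u|.
    by apply: leq_trans (leq_imset_card f _); apply/subset_leq_card/subsetIr.
  have : deg e (D :\ u) u * c <= d * c by rewrite leq_mul2r dS orbT.
  by move: hcard; lia.
have emb' := partial_emb_extend emb _ yf hy.
exists [eta f with u |-> y]; split.
- by rewrite -(setD1K uD); apply: emb'; rewrite setD11.
- apply/subsetP=> z /imsetP[v vD ->] /=; case: eqP => // vu.
  by apply: (subsetP im); rewrite imset_f // !inE vD andbT; apply/eqP.
- move=> v vS0 /=; case: eqP => [vu|_]; last exact: f0E.
  by rewrite -vu vS0 in uS0.
Qed.

End Embedding.

(** * Counting vertices when all suspended paths are short *)

Section SuspendedPaths.
Variables (T : finType) (e : rel T).
Hypotheses (e_sym : symmetric e) (e_irr : irreflexive e).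
Variable D : {set T}.
Implicit Types (s : seq T) (u v : T).

Definition degree_two := [set u in D | deg e D u == 2].

Definition suspended s := [/\ uniq s, sorted e s & {subset s <= degree_two}].

Lemma degree_two_nbrs u a b v : u \in degree_two -> a \in D -> b \in D -> v \in D ->
  a != b -> e u a -> e u b -> e u v = (v == a) || (v == b).
Proof.
rewrite inE => /andP[uD /eqP du] aD bD vD ab ua ub.
have sub : [set a; b] \subset [set w in D | e u w].
  by apply/subsetP=> w; rewrite !inE => /orP[]/eqP->; rewrite ?aD ?bD.
have /eqP E : [set a; b] == [set w in D | e u w].
  by rewrite eqEcard sub cards2 ab -[#|_|]/(deg e D u) du.
by have := in_set2 v a b; rewrite E inE vD /=.
Qed.

(** A path through [v] is extended at its ends as long as possible. When it is stuck, it is closed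
    under adjacency among vertices of degree two, so it contains the whole component of [v]. *)
Lemma suspended_grow v j : v \in degree_two ->
  (exists s, [/\ suspended s, size s = j.+1 & v \in s]) \/
  (exists s, [/\ size s <= j, v \in s &
     forall a b, a \in s -> b \in degree_two -> e a b -> b \in s]).
Proof.
move=> vD2; elim: j => [|j [[s [[us ss sD2] szs vs]]|[s [szs vs cs]]]].
- left; exists [:: v]; rewrite mem_head; split=> //; split=> // w.
  by rewrite inE => /eqP ->.
- have [/existsP[a /existsP[b /and4P[as_ bD2 eab bs]]]|/negP ncl] :=
    boolP [exists a, exists b, [&& a \in s, b \in degree_two, e a b & b \notin s]]; last first.
    right; exists s; split=> //; first by rewrite szs.
    move=> a b as_ bD2 eab; apply: contraT => bs; case: ncl.
    by apply/existsP; exists a; apply/existsP; exists b; rewrite as_ bD2 eab bs.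
  left; have [i ilt ai] := (nthP v as_).
  have [i0|ipos] := posnP i.
    exists (b :: s); rewrite /= szs inE vs orbT; split=> //; split; rewrite /= ?bs ?us //.
      case: s {us sD2 szs vs as_ bs ilt} ss ai => //= c s ss; rewrite i0 /= => ca.
      by rewrite ca e_sym eab -ca.
    by move=> w; rewrite inE => /predU1P[->//|/sD2].
  have [iE|ilt'] := eqVneq i.+1 (size s).
    exists (rcons s b); rewrite size_rcons szs mem_rcons inE vs orbT; split=> //; split.
    - by rewrite rcons_uniq bs us.
    - case: s {us sD2 vs as_ bs szs} ss ai iE ilt => //= c s ss ai [iE] _.
      by rewrite rcons_path ss (last_nth v) -iE ai.
    by move=> w; rewrite mem_rcons inE => /predU1P[->//|/sD2].
  (* An inner vertex has both its neighbours on the path already, so [b] cannot be a further one. *)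
  have inx : i.+1 < size s by rewrite ltn_neqAle ilt'.
  have /sortedP ss' := ss.
  have e1 : e a (nth v s i.+1) by rewrite -ai ss'.
  have e2 : e a (nth v s i.-1) by rewrite -ai e_sym -{2}(prednK ipos) ss' ?prednK.
  have sD w : w \in s -> w \in D by move/sD2; rewrite inE => /andP[].
  have m1 : nth v s i.+1 \in s by rewrite mem_nth.
  have m2 : nth v s i.-1 \in s by rewrite mem_nth // prednK // ltnW.
  have ne : nth v s i.+1 != nth v s i.-1.
    rewrite nth_uniq ?(leq_ltn_trans (leq_pred _) ilt) //.
    by rewrite neq_ltn ltnS leq_pred orbT.
  have := @degree_two_nbrs a _ _ b (sD2 _ as_) (sD _ m1) (sD _ m2) _ ne e1 e2.
  rewrite eab; move: bD2; rewrite inE => /andP[-> _] /(_ isT).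
  by case: eqP => [bE|_]; [rewrite bE m1 in bs | case: eqP => // bE; rewrite bE m2 in bs].
- by right; exists s; split=> //; apply: leqW.
Qed.

Let e2 u v := [&& u \in degree_two, v \in degree_two & e u v].

Lemma card_degree_two_component r v : v \in degree_two ->
  (forall s, suspended s -> size s != r.+1) -> #|[set u | connect e2 v u]| <= r.
Proof.
move=> vD2 hs; case: (suspended_grow r vD2) => [[s [sus szs _]]|[s [szs vs cs]]].
  by have := hs s sus; rewrite szs eqxx.
apply: leq_trans (leq_trans (card_size s) szs); apply/subset_leq_card/subsetP=> u.
rewrite inE => /connectP[p]; elim: p v vs {vD2} => [|w p IH] v vs /=; first by move=> _ ->.
by case/andP=> /and3P[_ wD2 evw] pp; apply: IH => //; apply: cs evw.
Qed.

(** Let [X] be the set of vertices of degree other than two and [s] its degree sum. The edge bound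
    gives [s <= 2 * #|X| + 2 * l], and [3 * #|X| <= s + 2 * p] since only leaves have degree below
    three in [X]. Hence [#|X| <= 2 * p + 2 * l] and [s <= 4 * p + 6 * l]. Each component of the
    remaining vertices has at most [r] vertices and is joined to [X] by an edge, so there are at
    most [s] of them. *)
Lemma card_no_long_suspended l r : connected_on e D ->
  degsum e D <= 2 * #|D| + 2 * l -> 0 < r ->
  (forall s, suspended s -> size s != r.+1) ->
  #|D| <= (4 * #|[set u in D | deg e D u == 1]| + 6 * l) * r
          + 2 * #|[set u in D | deg e D u == 1]| + 2 * l + r.
Proof.
move=> cD hD r0 hs; set p := #|[set _ in _ | _ == 1]|.
have e2s : symmetric e2 by move=> a b; rewrite /e2 e_sym andbCA.
have c2s : connect_sym e2 by apply: sym_connect_sym.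
pose comp v := [set u | connect e2 v u].
have compD v : v \in degree_two -> comp v \subset degree_two.
  move=> vD2; apply/subsetP=> u; rewrite inE c2s => /connectP[[|w q] /=]; first by move=> _ <-.
  by case/andP=> /and3P[].
have sD2 : degree_two \subset D by apply/subsetP=> u; rewrite inE => /andP[].
pose X := D :\: degree_two.
(* A component of the degree-two vertices is left only through [X]. *)
have leave v : v \in degree_two -> comp v != D ->
    exists x u, [/\ x \in X, u \in comp v & e x u].
  move=> vD2 nD; have [||//|a [b [aS /setDP[bD bS] eab]]] := cD (comp v).
  - exact: subset_trans (compD _ vD2) sD2.
  - by apply/set0Pn; exists v; rewrite inE connect0.
  exists b, a; rewrite e_sym; split=> //; rewrite inE bD andbT.
  apply: contra bS => bD2; rewrite inE; move: (aS); rewrite inE => va.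
  apply: connect_trans va (connect1 _); rewrite /e2 bD2 eab.
  by rewrite (subsetP (compD _ vD2)).
(* If every vertex has degree two, [D] is a single component; this case accounts for the final
   summand [r]. *)
have [X0|Xn] := eqVneq X set0.
  have D2E : degree_two = D by apply/eqP; rewrite eqEsubset sD2 -setD_eq0 -/X X0 eqxx.
  have [->|/set0Pn[v vD]] := eqVneq D set0; first by rewrite cards0.
  have vD2 : v \in degree_two by rewrite D2E.
  have [<-|/(leave _ vD2)[x [u []]]] := eqVneq (comp v) D; last by rewrite X0 inE.
  by apply: leq_trans (card_degree_two_component vD2 hs) _; rewrite leq_addl.
have [D1|D1] := leqP #|D| 1; first by lia.
have deg0 u : u \in D -> 0 < deg e D u.
  move=> uD; have [|||a [b [/set1P-> /setDP[bD _] eab]]] := cD [set u].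
  - by rewrite sub1set.
  - by apply/set0Pn; exists u; rewrite inE.
  - by apply: contraTneq D1 => <-; rewrite cards1.
  by apply/card_gt0P; exists b; rewrite inE bD.
have cardD : #|D| = #|degree_two| + #|X|.
  by have := cardsID degree_two D; rewrite (setIidPr sD2).
have sumD : degsum e D = 2 * #|degree_two| + \sum_(x in X) deg e D x.
  rewrite /degsum (big_setID degree_two) /= (setIidPr sD2); congr (_ + _).
  rewrite mulnC -sum_nat_const; apply: eq_bigr => u; rewrite inE.
  by case/andP=> _ /eqP.
have sumX : 3 * #|X| <= \sum_(x in X) deg e D x + 2 * p.
  have -> : 2 * p = \sum_(x in X) (deg e D x == 1) * 2.
    rewrite -big_distrl /= mulnC; congr (_ * _).
    rewrite /p -sum1_card -[RHS]big_mkcondr.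
    by apply: eq_bigl => u; rewrite !inE; case: eqP => [->|]; rewrite ?andbF ?andbT.
  rewrite mulnC -sum_nat_const -big_split /=; apply: leq_sum => x.
  rewrite !inE => /andP[nd2 xD]; rewrite xD /= in nd2.
  by move: nd2 (deg0 _ xD); case: (deg e D x) => [|[|[|d]]].
have cardD2 : #|degree_two| <= (\sum_(x in X) deg e D x) * r.
  have sub : degree_two \subset \bigcup_(x in X) \bigcup_(u in [set u in degree_two | e x u]) comp u.
    apply/subsetP=> v vD2.
    have [|x [u [xX uv exu]]] := leave v vD2.
      apply: contraNneq Xn => cE; rewrite setD_eq0 -cE; exact: compD.
    have uD2 : u \in degree_two by apply: (subsetP (compD _ vD2)).
    apply/bigcupP; exists x => //; apply/bigcupP; exists u; first by rewrite inE uD2.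
    by rewrite inE c2s; rewrite inE in uv.
  apply: leq_trans (subset_leq_card sub) _.
  apply: leq_trans (card_bigcup_leq _ _) _; rewrite big_distrl /=.
  apply: leq_sum => x _; apply: leq_trans (card_bigcup_leq _ _) _.
  apply: (@leq_trans (\sum_(u in [set u in degree_two | e x u]) r)).
    by apply: leq_sum => u; rewrite inE => /andP[uD2 _]; apply: card_degree_two_component.
  rewrite sum_nat_const leq_mul2r; apply/orP; right.
  by apply: deg_mono.
have sX : \sum_(x in X) deg e D x <= 4 * p + 6 * l by lia.
have : (\sum_(x in X) deg e D x) * r <= (4 * p + 6 * l) * r by rewrite leq_mul2r sX orbT.
by lia.
Qed.

End SuspendedPaths.

(** * Hosts without a blue book *)

(** The host [R] is the red graph, and blue is adjacency in its complement. *)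
Definition book_free k (R : sgraph) := forall x y : R, compl_rel x y ->
  #|[set z | compl_rel x z && compl_rel y z]| < k.

(** Two vertices of a blue clique have all its other vertices as common blue neighbours. *)
Lemma blue_clique_leq k (R : sgraph) (Q : {set R}) : book_free k R ->
  {in Q &, forall x y, x != y -> compl_rel x y} -> #|Q| <= k.+1.
Proof.
move=> bf hQ; have [|/card_gt1P[x [y [xQ yQ xy]]]] := leqP #|Q| 1; first by lia.
have := bf x y (hQ x y xQ yQ xy).
have sub : Q :\ x :\ y \subset [set z | compl_rel x z && compl_rel y z].
  apply/subsetP=> z; rewrite !inE => /and3P[zy zx zQ].
  by rewrite !hQ // eq_sym.
have := subset_leq_card sub.
have := cardsD1 x Q; have := cardsD1 y (Q :\ x).
by rewrite !inE eq_sym xy xQ yQ /=; lia.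
Qed.

(** * Red detours of a path through an additional vertex *)

Section PathInsertion.
Variables (A : eqType) (r : rel A).
Implicit Types (p q s : seq A).

Lemma sorted_insert p q y z0 : symmetric r -> sorted r (p ++ q) ->
  p != [::] -> q != [::] -> r y (last z0 p) -> r y (head z0 q) ->
  sorted r (p ++ y :: q).
Proof.
move=> rs; case: p => // a p; case: q => // b q /=; rewrite !cat_path /=.
by move=> /and3P[-> _ ->] _ _; rewrite rs => -> ->.
Qed.

(** From the end of [p] the new path goes to [y], runs through [q] backwards, and crosses from the
    head of [q] to the head of [s]. *)
Lemma sorted_rotate p q s y z0 : symmetric r -> sorted r (p ++ q ++ s) ->
  p != [::] -> q != [::] -> s != [::] ->
  r y (last z0 p) -> r y (last z0 q) -> r (head z0 q) (head z0 s) ->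
  sorted r (p ++ y :: rev q ++ s).
Proof.
move=> rs; case: p => // a p; case: q => // b q; case: s => // c s /=.
rewrite !cat_path /= cat_path /= => /and5P[ap _ bq _ cs] _ _ _.
rewrite [r y (last a p)]rs => py yq bc.
rewrite ap py lastI rev_rcons /= yq cat_path rev_path (eq_path (e' := r)) //= bq cs.
suff -> : last (last b q) (rev (belast b q)) = b by rewrite bc.
by case: q {bq yq} => //= d q; rewrite rev_cons last_rcons.
Qed.

End PathInsertion.

Section Reroute.
Variables (R : sgraph) (T : finType) (e : rel T).
Hypotheses (e_sym : symmetric e) (e_irr : irreflexive e).
Variables (D : {set T}) (x0 x1 x2 : T) (s s' : seq T).
Hypothesis sE : s = [:: x0, x1, x2 & s'].
Hypothesis s_susp : suspended e D s.
Variable f : T -> R.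

Lemma reroute (t : seq R) (y0 : R) : partial_emb e (D :\ x1) f ->
  size t = size s -> uniq t -> sorted sedge t ->
  head y0 t = f x0 -> last y0 t = f (last x0 s) ->
  {in t, forall z, z \in [seq f x | x <- [:: x0, x2 & s']] \/ z \notin f @: (D :\ x1)} ->
  exists g : T -> R, partial_emb e D g.
Proof.
move=> [fi fe] szt ut st t0 tl tout.
have [us ss sD2] := s_susp.
have sD v : v \in s -> v \in D by move/sD2; rewrite inE => /andP[].
pose g v := if v \in s then nth y0 t (index v s) else f v.
pose inner v := [&& v \in s, 0 < index v s & (index v s).+1 < size s].
have inner1 : inner x1.
  have := us; rewrite sE /= inE negb_or => /andP[/andP[x01 _] _].
  by rewrite /inner sE !inE eqxx orbT /= (negPf x01) eqxx.
have gE v : ~~ inner v -> g v = f v.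
  rewrite /inner /g; case: ifP => // vs; have := vs; rewrite -index_mem => vs'.
  rewrite andTb negb_and -!leqNgt leqn0 => /orP[/eqP i0|il].
    by rewrite i0 nth0 t0; congr (f _); have := nth_index x0 vs; rewrite i0 sE.
  have iE : index v s = (size s).-1.
    by apply/eqP; rewrite -eqSS prednK ?eqn_leq ?vs' //; apply: leq_ltn_trans vs'.
  rewrite iE -{1}szt nth_last tl; congr (f _).
  by rewrite -nth_last -iE nth_index.
have D1 v : v \in D -> ~~ inner v -> v \in D :\ x1.
  by move=> vD vi; rewrite !inE vD andbT; apply: contraNneq vi => ->.
have sorted_t i : i.+1 < size s -> sedge (nth y0 t i) (nth y0 t i.+1).
  by rewrite -szt; apply/sortedP.
have edge u v : v \in D -> e u v -> inner u -> sedge (g u) (g v).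
  move=> vD euv /and3P[us_ ipos ilt].
  set i := index u s in ipos ilt.
  have ui : nth x0 s i = u by rewrite nth_index.
  have /sortedP ss' := ss.
  have e1 : e u (nth x0 s i.+1) by rewrite -ui ss'.
  have e2 : e u (nth x0 s i.-1) by rewrite -ui e_sym -{2}(prednK ipos) ss' ?prednK // ltnW.
  have m1 : nth x0 s i.+1 \in s by rewrite mem_nth.
  have m2 : nth x0 s i.-1 \in s by rewrite mem_nth // (leq_ltn_trans (leq_pred _) (ltnW ilt)).
  have ne : nth x0 s i.+1 != nth x0 s i.-1.
    rewrite nth_uniq ?(leq_ltn_trans (leq_pred _) (ltnW ilt)) //.
    by rewrite neq_ltn ltnS leq_pred orbT.
  have := degree_two_nbrs (sD2 _ us_) (sD _ m1) (sD _ m2) vD ne e1 e2.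
  rewrite euv /g us_ -/i => /esym/orP[]/eqP ->.
    by rewrite m1 index_uniq // sorted_t.
  rewrite m2 index_uniq //; last exact: leq_ltn_trans (leq_pred _) (ltnW ilt).
  by rewrite sedge_sym -{2}(prednK ipos) sorted_t ?prednK // ltnW.
have off u v : u \in s -> v \notin s -> v \in D -> g u <> g v.
  move=> us_ vs vD; rewrite /g us_ (negPf vs) => guv.
  have vD1 : v \in D :\ x1 by apply: D1 => //; rewrite /inner (negPf vs).
  have [|/mapP[w ws fvw]|] := tout (nth y0 t (index u s)).
  - by rewrite mem_nth // szt index_mem.
  - have ws' : w \in s by move: ws; rewrite sE !inE => /or3P[]->; rewrite ?orbT.
    suff : v = w by move=> vw; rewrite vw ws' in vs.
    apply: fi => //; last by rewrite -guv.
    rewrite !inE sD // andbT; apply: contraTneq ws => ->.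
    by move: us; rewrite sE /= !inE !negb_or => /and3P[/and3P[x01 _ _] /andP[-> ->] _]; rewrite eq_sym x01.
  - by rewrite guv imset_f.
exists g; split=> u v uD vD.
  have [us_|us_] := boolP (u \in s); have [vs|vs] := boolP (v \in s).
  - rewrite /g us_ vs => /eqP; rewrite nth_uniq ?szt ?index_mem // => /eqP.
    by move/(congr1 (nth x0 s)); rewrite !nth_index.
  - by move/(off u v us_ vs vD).
  - by move/esym/(off v u vs us_ uD).
  - rewrite /g (negPf us_) (negPf vs); apply: fi; apply: D1 => //.
      by rewrite /inner (negPf us_).
    by rewrite /inner (negPf vs).
move=> euv; have [ui|ui] := boolP (inner u); first exact: edge.
have [vi|vi] := boolP (inner v); first by rewrite sedge_sym edge // e_sym.
by rewrite !gE //; apply: fe; rewrite ?D1.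
Qed.

End Reroute.

(** * Recovering an embedding of the guest from one of the shortened guest *)

Section Unshorten.
Variables (R : sgraph) (T : finType) (e : rel T) (k : nat).
Hypotheses (e_sym : symmetric e) (e_irr : irreflexive e) (bf : book_free k R).
Variables (D : {set T}).

Lemma embed_red_clique (Y : {set R}) (f0 : T -> R) :
  {in Y &, forall x y, x != y -> sedge x y} ->
  #|D| <= #|Y| -> exists g : T -> R, partial_emb e D g.
Proof.
move=> hY cY.
have [||x xY|||g [gemb _ _]] :=
  @greedy_embedding R T e e_sym e_irr Y set0 D f0 #|D| 0 (sub0set _).
- by split=> u; rewrite inE.
- by rewrite imset0 sub0set.
- rewrite leqn0 cards_eq0; apply/eqP/setP=> y; rewrite !inE.
  apply/negbTE/negP=> /and3P[yY xy /negP]; apply; exact: hY.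
- move=> S _ SD /set0Pn[u uS]; exists u; first by rewrite setD0.
  by apply/subset_leq_card/subsetP=> v; rewrite inE => /andP[/(subsetP SD)].
- by rewrite muln0 addn0.
by exists g.
Qed.

Variables (x0 x1 x2 : T) (s s' : seq T) (f : T -> R).
Hypotheses (sE : s = [:: x0, x1, x2 & s']) (s_susp : suspended e D s).

(** The bound on [#|D|] serves the outcome in which the vertices outside the image form a red
    clique, which must then hold all of [D]. *)
Lemma unshorten : size s = 3 * k + 3 ->
  partial_emb (add_edge e x0 x2) (D :\ x1) f ->
  #|D| <= #|~: f @: (D :\ x1)| -> exists g : T -> R, partial_emb e D g.
Proof.
move=> szs emb cY; set D' := D :\ x1 in emb cY *.
have [us ss sD2] := s_susp.
have emb0 : partial_emb e D' f.
  by have [fi fe] := emb; split=> // u v uD vD euv; apply: fe => //; rewrite /add_edge euv.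
set p := [seq f x | x <- [:: x0, x2 & s']].
have sub' : {subset [:: x0, x2 & s'] <= D'}.
  move=> v vs; have vs' : v \in s by move: vs; rewrite sE !inE => /or3P[]->; rewrite ?orbT.
  have := sD2 v vs'; rewrite !inE => /andP[-> _]; rewrite andbT.
  apply: contraTneq vs => ->; move: us; rewrite sE /= !inE !negb_or.
  by move=> /and3P[/and3P[x01 _ _] /andP[-> ->] _]; rewrite eq_sym x01.
have us' : uniq [:: x0, x2 & s'].
  by move: us; rewrite sE /= !inE !negb_or => /and3P[/and3P[_ -> ->] _ ->].
have szp : size p = 3 * k + 2 by rewrite size_map; move: szs; rewrite sE /=; lia.
have up : uniq p by rewrite map_inj_in_uniq //; move=> u v /sub' uD /sub' vD; apply: emb.1.
have sp : sorted sedge p.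
  have : sorted (add_edge e x0 x2) [:: x0, x2 & s'].
    move: ss; rewrite sE /= => /and3P[_ _ h]; apply/andP; split.
      by rewrite /add_edge !eqxx orbT.
    by apply: sub_path h => u v; rewrite /add_edge => ->.
  rewrite sorted_map; apply: (@sub_in_sorted _ (mem D')); last exact/allP.
  by move=> u v uD vD; apply: emb.2.
have pD' z : z \in p -> z \in f @: D' by case/mapP=> v /sub' vD ->; rewrite imset_f.
set Y := ~: f @: D' in cY.
have pY y : y \in Y -> y \notin p by rewrite inE; apply: contra; apply: pD'.
pose z0 := f x0.
have p_0 : head z0 p = f x0 by [].
have p_l : last z0 p = f (last x0 s) by rewrite sE /= last_map.
have done_with t y : y \in Y -> perm_eq t (y :: p) -> sorted sedge t ->
    head z0 t = f x0 -> last z0 t = f (last x0 s) -> exists g : T -> R, partial_emb e D g.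
  move=> yY pt st t0 tl; apply: (reroute e_sym sE s_susp emb0 _ _ st t0 tl).
  - by rewrite (perm_size pt) szs -[size (y :: p)]/(size p).+1 szp -!addnS.
  - by rewrite (perm_uniq pt) cons_uniq pY.
  - move=> z; rewrite (perm_mem pt) inE => /predU1P[->|zp]; last by left.
    by right; move: yY; rewrite inE.
clearbody p.
have ptake i : i.+1 < size p -> [/\ take i.+1 p != [::], drop i.+1 p != [::],
    last z0 (take i.+1 p) = nth z0 p i & head z0 (drop i.+1 p) = nth z0 p i.+1].
  move=> ip; split.
  - by rewrite -size_eq0 size_take ip.
  - by rewrite -size_eq0 size_drop subn_eq0 -ltnNge.
  - by rewrite -nth_last size_take ip nth_take.
  - by rewrite -nth0 nth_drop addn0.
have htake i q : i.+1 < size p -> head z0 (take i.+1 p ++ q) = f x0.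
  by move=> ip; rewrite -nth0 nth_cat size_take ip nth_take // nth0.
pose insertable (y : R) (i : nat) := [&& i.+1 < size p, sedge y (nth z0 p i) & sedge y (nth z0 p i.+1)].
have [/existsP[y /andP[yY /existsP[i /and3P[ip yi yi1]]]]|/existsPn noins] :=
    boolP [exists y in Y, exists i : 'I_(size p), insertable y i].
  have [n1 n2 l1 h2] := ptake i ip.
  apply: (@done_with (take i.+1 p ++ y :: drop i.+1 p) y) => //.
  - by apply/permP=> a; have := congr1 (count a) (cat_take_drop i.+1 p);
    rewrite !count_cat /= => <-; rewrite addnCA.
  - by apply: (@sorted_insert _ _ _ _ _ z0); rewrite ?l1 ?h2 // ?cat_take_drop //; apply: sedge_sym.
  - exact: htake.
  - by rewrite last_cat /= -p_l -[in RHS](cat_take_drop i.+1 p) last_cat; case: (drop _ _) n2.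
(* The detour follows the path up to position [i], visits [y], jumps to position [j], runs back to
   [i + 1], and resumes at [j + 1]. *)
pose rotatable (y : R) (i j : nat) := [&& i < j, j.+1 < size p, sedge y (nth z0 p i),
  sedge y (nth z0 p j) & sedge (nth z0 p i.+1) (nth z0 p j.+1)].
have [/existsP[y /andP[yY /existsP[i /existsP[j /and5P[ij jp yi yj ij1]]]]]|/existsPn norot] :=
    boolP [exists y in Y, exists i : 'I_(size p), exists j : 'I_(size p), rotatable y i j].
  have [n1 n2 l1 h2] := ptake i (leq_ltn_trans ij (ltnW jp)).
  have [n3 n4 l3 h4] := ptake j jp.
  pose q := drop i.+1 (take j.+1 p).
  have pE : p = take i.+1 p ++ q ++ drop j.+1 p.
    have le_ij : i.+1 <= j.+1 by apply: ltnW.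
    have := cat_take_drop i.+1 (take j.+1 p); rewrite take_takel // => tj.
    by rewrite catA /q tj cat_take_drop.
  have qn : q != [::] by rewrite -size_eq0 size_drop size_take jp subn_eq0 -ltnNge.
  have ql : last z0 q = nth z0 p j.
    rewrite -nth_last nth_drop size_drop size_take jp.
    have -> : i.+1 + (j.+1 - i.+1).-1 = j by rewrite subSS -subn1 -subnDA addn1 addnC subnK.
    by rewrite nth_take.
  have qh : head z0 q = nth z0 p i.+1 by rewrite -nth0 nth_drop addn0 nth_take.
  apply: (@done_with (take i.+1 p ++ y :: rev q ++ drop j.+1 p) y) => //.
  - apply/permP=> a; have := congr1 (count a) pE.
    by rewrite !count_cat /= count_cat count_rev => ->; rewrite addnCA.
  - by apply: (@sorted_rotate _ _ _ _ _ _ z0); rewrite ?l1 ?ql ?qh ?h4 // -?pE //; apply: sedge_sym.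
  - exact: htake (leq_ltn_trans ij (ltnW jp)).
  - by rewrite last_cat /= last_cat -p_l [in RHS]pE !last_cat; case: (drop j.+1 p) n4.
(* With neither move available, [y] together with the successors of its red
   neighbours on the path is a blue clique. *)
have few y : y \in Y -> #|[set z in p | sedge y z]| <= k.+1.
  move=> yY.
  pose I := [set i : 'I_(size p) | (i.+1 < size p) && sedge y (nth z0 p i)].
  have bluey i : i \in I -> compl_rel y (nth z0 p i.+1).
    rewrite inE => /andP[ip yi]; rewrite /compl_rel.
    have := noins y; rewrite yY /= => /existsPn/(_ i); rewrite /insertable ip yi /= => ->.
    by rewrite andbT; apply: contraNneq (pY y yY) => ->; rewrite mem_nth.
  have inj : {in I &, injective (fun i : 'I_(size p) => nth z0 p i.+1)}.
    move=> i j; rewrite !inE => /andP[ip _] /andP[jp _] /eqP.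
    by rewrite nth_uniq // eqSS => /eqP/val_inj.
  have blue_lt (i j : 'I_(size p)) : i \in I -> j \in I -> i < j -> compl_rel (nth z0 p i.+1) (nth z0 p j.+1).
    rewrite !inE => /andP[ip yi] /andP[jp yj] ij; rewrite /compl_rel nth_uniq // eqSS neq_ltn ij /=.
    have := norot y; rewrite yY /= => /existsPn/(_ i)/existsPn/(_ j).
    by rewrite /rotatable ij jp yi yj.
  have hQ := @blue_clique_leq k R (y |: [set nth z0 p i.+1 | i : 'I_(size p) in I]) bf.
  have yQ : y \notin [set nth z0 p i.+1 | i : 'I_(size p) in I].
    apply: contra (pY y yY) => /imsetP[i]; rewrite inE => /andP[ip _ ->].
    by rewrite mem_nth.
  have cI : #|I| <= k.
    move: hQ; rewrite cardsU1 yQ card_in_imset // add1n ltnS; apply.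
    have csym : symmetric (@compl_rel R) by apply: compl_rel_sym.
    move=> a b; rewrite !inE => /predU1P[->|/imsetP[i iI ->]] /predU1P[->|/imsetP[j jI ->]].
    - by rewrite eqxx.
    - by move=> _; apply: bluey.
    - by move=> _; rewrite csym; apply: bluey.
    - have [ij|ji|/val_inj->] := ltngtP i j; last by rewrite eqxx.
        by move=> _; apply: blue_lt.
      by move=> _; rewrite csym; apply: blue_lt.
  (* The last path vertex has no successor and is counted apart, whence [k + 1] instead of [k]. *)
  have sub : [set z in p | sedge y z] \subset last z0 p |: [set nth z0 p i | i : 'I_(size p) in I].
    apply/subsetP=> z; rewrite !inE => /andP[zp yz].
    have ip : index z p < size p by rewrite index_mem.
    have zE : z = nth z0 p (index z p) by rewrite nth_index.
    have [ilast|nl] := eqVneq (index z p).+1 (size p).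
      have -> : last z0 p = z by rewrite -nth_last -ilast nth_index.
      by rewrite eqxx.
    apply/orP; right; apply/imsetP; exists (Ordinal ip) => //=.
    by rewrite inE /= ltn_neqAle nl ip -zE.
  apply: leq_trans (subset_leq_card sub) _.
  rewrite cardsU1; have := leq_imset_card (fun i : 'I_(size p) => nth z0 p i) I.
  by move: cI; case: (_ \notin _); clear; lia.
(* Of the [3 * k + 2] path vertices at most [2 * (k + 1)] are red neighbours of [y] or [z]; the
   other [k] would be pages of a book on a blue edge [y z]. *)
apply: (@embed_red_clique Y f) => // y z yY zY yz; apply: contraT => nyz.
have byz : compl_rel y z by rewrite /compl_rel yz.
have := bf byz.
have sub : [set w in p] \subset ([set w in p | sedge y w] :|: [set w in p | sedge z w])
    :|: [set w | compl_rel y w && compl_rel z w].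
  apply/subsetP=> w; rewrite !inE /compl_rel => wp; rewrite wp /=.
  case: (sedge y w) => //=; case: (sedge z w) => //=; rewrite !andbT.
  by apply/andP; split; apply: contraTneq wp => <-; apply: pY.
have := subset_leq_card sub; rewrite cardsE (card_uniqP up) szp.
have := (leq_card_setU ([set w in p | sedge y w] :|: [set w in p | sedge z w])
  [set w | compl_rel y w && compl_rel z w]).1.
have := (leq_card_setU [set w in p | sedge y w] [set w in p | sedge z w]).1.
have := few y yY; have := few z zY.
by clear; lia.
Qed.

End Unshorten.

(** * Structure of blue neighbourhoods *)

Lemma exists_subset_card (T : finType) (B : {set T}) j : j <= #|B| ->
  exists2 A : {set T}, A \subset B & #|A| = j.
Proof.
elim: j => [|j IH] hj; first by exists set0; rewrite ?sub0set ?cards0.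
have [A sAB cA] := IH (ltnW hj).
have /subsetPn[x xB xA] : ~~ (B \subset A).
  by apply: contraTN hj => /subset_leq_card; rewrite cA -leqNgt.
exists (x |: A); last by rewrite cardsU1 xA cA.
by rewrite subUset sub1set xB.
Qed.

Section BlueNeighbourhood.
Variables (R : sgraph) (k : nat).
Hypothesis bf : book_free k R.
Let blue := @compl_rel R.

Lemma blue_deg_nbhd (A : {set R}) v x : A \subset [set y | blue v y] -> x \in A ->
  deg blue A x <= k.-1.
Proof.
move=> sA xA; have vx : blue v x by have := subsetP sA x xA; rewrite inE.
have := bf vx; suff : deg blue A x <= #|[set z | compl_rel v z && compl_rel x z]| by lia.
apply/subset_leq_card/subsetP=> z; rewrite !inE => /andP[/(subsetP sA)].
by rewrite inE => vz xz; apply/andP.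
Qed.

(** If [x] and [y] in [A] are joined in blue, all but fewer than [k] of the vertices outside [A] are
    red neighbours of [x] or [y], so one of the two has many of them. *)
Lemma good_vertex (A : {set R}) : A != set0 -> 3 * k <= #|~: A| ->
  exists2 x, x \in A & (forall y, y \in A -> ~~ blue x y) \/
    k.-1 <= #|[set y in ~: A | sedge x y]|.
Proof.
move=> /set0Pn[x xA] cA.
have [/existsP[y /andP[yA xy]]|/existsPn h] := boolP [exists y, (y \in A) && blue x y]; last first.
  by exists x => //; left=> y yA; have := h y; rewrite yA.
have := bf xy.
have sub : ~: A \subset ([set z in ~: A | sedge x z] :|: [set z in ~: A | sedge y z])
    :|: [set z | compl_rel x z && compl_rel y z].
  apply/subsetP=> z; rewrite !inE /compl_rel => zA; rewrite zA /=.
  case: (sedge x z) => //=; case: (sedge y z) => //=; rewrite !andbT.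
  by apply/andP; split; apply: contraNneq zA => <-.
have := subset_leq_card sub.
have := (leq_card_setU ([set z in ~: A | sedge x z] :|: [set z in ~: A | sedge y z])
  [set z | compl_rel x z && compl_rel y z]).1.
have := (leq_card_setU [set z in ~: A | sedge x z] [set z in ~: A | sedge y z]).1.
move=> h1 h2 h3 h4.
have [hx|hx] := leqP k.-1 #|[set z in ~: A | sedge x z]|; first by exists x => //; right.
exists y => //; right; move: h1 h2 h3 h4 hx cA; clear; lia.
Qed.

End BlueNeighbourhood.

(** * Embedding small guests and guests with many leaves *)

Section Embedding.
Variables (R : sgraph) (k : nat).
Hypothesis bf : book_free k R.
Variables (T : finType) (e : rel T).
Hypotheses (e_sym : symmetric e) (e_irr : irreflexive e).
Variables (D : {set T}) (l d : nat) (f0 : T -> R).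
Hypotheses (D_conn : connected_on e D) (D_sum : degsum e D <= 2 * #|D| + 2 * l).
Hypothesis hd : 2 * l < d.-1 * d.+2.
Let blue := @compl_rel R.

Lemma greedy_in_nbhd (A : {set R}) (H : {set T}) :
  (forall x, x \in A -> deg blue A x <= k.-1) -> H \subset D ->
  #|H| + d * k.-1 <= #|A| ->
  exists f : T -> R, partial_emb e H f /\ f @: H \subset A.
Proof.
move=> hA HD cH.
have [||S _ SH /set0Pn S0|f [femb fA _]] :=
  @greedy_embedding R T e e_sym e_irr A set0 H f0 d k.-1 (sub0set _) _ _ hA _ cH.
- by split=> u; rewrite inE.
- by rewrite imset0 sub0set.
- have [||u [uS du _]] := degenerate e_sym e_irr D_conn D_sum hd (S := S).
  + exact: subset_trans SH HD.
  + exact/set0Pn.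
  by exists u; rewrite ?setD0.
by exists f.
Qed.

(** Subsets of [D] are embedded by growing size. If some blue degree is at least
    [#|S| + d * (k - 1)], then [S] fits greedily into that blue neighbourhood. Otherwise a vertex
    [u] of minimum degree is placed last: its neighbours exclude at most
    [deg S u * (#|S| + d * (k - 1))] vertices, and [deg S u * #|S|] is bounded by the edge count. *)
Lemma embed_small : 3 * #|D| + 2 * l + d * (d * k.-1) <= #|R| ->
  exists f : T -> R, partial_emb e D f.
Proof.
move=> cD; suff : forall j (S : {set T}), #|S| = j -> S \subset D -> exists f : T -> R, partial_emb e S f.
  by apply.
elim=> [|j IH] S cS SD.
  by exists f0; split=> u v; rewrite (cards0_eq cS) inE.
have [/existsP[v hv]|/existsPn hv] := boolP [exists v, #|S| + d * k.-1 <= #|[set y | blue v y]|].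
  have [f [femb _]] := greedy_in_nbhd (fun x => @blue_deg_nbhd R k bf _ v x (subxx _)) SD hv.
  by exists f.
have S0 : S != set0 by rewrite -card_gt0 cS.
have [u [uS du hu]] := degenerate e_sym e_irr D_conn D_sum hd SD S0.
have cS1 : #|S :\ u| = j by move: cS; rewrite (cardsD1 u S) uS => -[].
have [f femb] := IH _ cS1 (subset_trans (subsetDl _ _) SD).
have [w wS ew||y [_ yf hy]] := @free_vertex R T e (S :\ u) f u setT (#|S| + d * k.-1).
- apply: ltnW; have := hv (f w); rewrite -ltnNge; apply: leq_ltn_trans.
  by apply/subset_leq_card/subsetP=> y; rewrite !inE.
- have h1 : #|setT :&: f @: (S :\ u)| <= j.
    by rewrite setTI -cS1; apply: leq_imset_card.
  have h2 : deg e (S :\ u) u <= deg e S u by apply: deg_mono (subsetDl _ _).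
  have h3 : deg e (S :\ u) u * (#|S| + d * k.-1) <= 2 * #|S| + 2 * l + d * (d * k.-1).
    apply: (@leq_trans (deg e S u * (#|S| + d * k.-1))); first by rewrite leq_mul2r h2 orbT.
    by rewrite mulnDr leq_add // leq_mul2r du orbT.
  have := subset_leq_card SD.
  by rewrite cardsT; move: h1 h3 cD; rewrite cS; clear; lia.
exists [eta f with u |-> y]; rewrite -(setD1K uS).
by apply: partial_emb_extend; rewrite ?setD11.
Qed.

Definition leaves := [set u in D | deg e D u == 1].

Lemma leaf_nbr x h w : x \in leaves -> h \in D -> w \in D -> e x h -> e x w -> w = h.
Proof.
rewrite inE => /andP[_ /cards1P[z zE]] hD wD xh xw.
have : h \in [set v in D | e x v] by rewrite inE hD.
have : w \in [set v in D | e x v] by rewrite inE wD.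
by rewrite zE !inE => /eqP-> /eqP->.
Qed.

Lemma leaf_has_nbr x : x \in leaves -> exists2 h, h \in D & e x h.
Proof.
rewrite inE => /andP[_ /cards1P[z zE]]; exists z.
  by have := set11 z; rewrite -zE inE => /andP[].
by have := set11 z; rewrite -zE inE => /andP[].
Qed.

Lemma leaf_nbr_notin x h : 2 < #|D| -> x \in leaves -> h \in D -> e x h -> h \notin leaves.
Proof.
move=> D2 xL hD xh; apply/negP=> hL.
have xD : x \in D by move: xL; rewrite inE => /andP[].
have [|||a [b [aS /setDP[bD bS] ab]]] := D_conn (S := [set x; h]).
- by apply/subsetP=> z; rewrite !inE => /orP[]/eqP->.
- by apply/set0Pn; exists x; rewrite !inE eqxx.
- by apply: contraTneq D2 => <-; rewrite cards2 -leqNgt; case: (_ != _).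
move: aS bS; rewrite !inE negb_or => aS /andP[bx bh].
case/orP: aS => /eqP aE; rewrite {}aE in ab.
  by rewrite (leaf_nbr xL hD bD xh ab) eqxx in bh.
by rewrite (leaf_nbr hL xD bD _ ab) ?eqxx // e_sym in bx.
Qed.

(** Vertices of [K] have no neighbour but [s], so any injection of [K] into [Z] extends [f]; the
    enumerations of the two sets supply one. *)
Lemma star_extension (D0 K : {set T}) (Z : {set R}) s (f : T -> R) :
  partial_emb e D0 f -> s \in D0 -> [disjoint D0 & K] ->
  (forall x w, x \in K -> w \in D0 :|: K -> e x w -> w = s) ->
  (forall z, z \in Z -> sedge (f s) z /\ z \notin f @: D0) -> #|K| <= #|Z| ->
  exists g : T -> R, partial_emb e (D0 :|: K) g.
Proof.
move=> [fi fe] sD0 dis hK hZ cKZ.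
pose h v := nth (f s) (enum Z) (index v (enum K)).
have ltK v : v \in K -> index v (enum K) < size (enum Z).
  by move=> vK; rewrite -cardE (leq_trans _ cKZ) // cardE index_mem mem_enum.
have hZ' v : v \in K -> h v \in Z by move=> vK; rewrite -mem_enum mem_nth // ltK.
have hi : {in K &, injective h}.
  move=> u v uK vK /eqP; rewrite nth_uniq ?ltK ?enum_uniq // => /eqP.
  by move/(congr1 (nth u (enum K))); rewrite !nth_index ?mem_enum.
have nK v : v \in D0 -> (v \in K) = false by move=> vD; apply: (disjointFr dis).
exists (fun v => if v \in K then h v else f v); split=> u v; rewrite !inE.
  have [uK|uK] := boolP (u \in K); have [vK|vK] := boolP (v \in K); rewrite ?orbT ?orbF.
  - by move=> _ _; apply: hi.
  - by move=> _ vD hf; have [_] := hZ _ (hZ' _ uK); rewrite hf imset_f.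
  - by move=> uD _ hf; have [_] := hZ _ (hZ' _ vK); rewrite -hf imset_f.
  - exact: fi.
have edge a b : a \in K -> (b \in D0) || (b \in K) -> e a b ->
    sedge (if a \in K then h a else f a) (if b \in K then h b else f b).
  move=> aK bD eab; have bs : b = s by apply: hK eab => //; rewrite inE.
  by rewrite aK bs nK // sedge_sym; have [] := hZ _ (hZ' _ aK).
move=> uD vD euv; have [uK|uK] := boolP (u \in K).
  by have := edge u v uK vD euv; rewrite uK.
have [vK|vK] := boolP (v \in K).
  by have := edge v u vK uD; rewrite e_sym sedge_sym vK (negPf uK); apply.
by move: uD vD; rewrite (negPf uK) (negPf vK) !orbF => uD vD; apply: fe.
Qed.

Variable A : {set R}.
Hypotheses (A_sparse : forall x, x \in A -> deg blue A x <= k.-1).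
Hypotheses (DA : #|D| <= #|A|) (D2 : 2 < #|D|) (k2 : 1 < k).

Let LD : leaves \subset D.
Proof. by apply/subsetP=> u; rewrite inE => /andP[]. Qed.

Let cardH : #|D :\: leaves| + #|leaves| = #|D|.
Proof. by have := cardsID leaves D; rewrite (setIidPr LD) addnC. Qed.

(** There are three stages: the non-leaves, starting with [s] at a good vertex; then the leaves
    outside [K]; finally the [k - 1] leaves in [K], all attached to [s]. *)
Lemma embed_hub s : s \in D -> k.-1 <= #|[set x in leaves | e s x]| ->
  d.+1 * k.-1 <= #|leaves| -> 3 * k <= #|~: A| ->
  exists f : T -> R, partial_emb e D f.
Proof.
move=> sD cs cL cA.
have [K sK cK] := exists_subset_card cs.
have KL x : x \in K -> x \in leaves /\ e s x by move/(subsetP sK); rewrite inE => /andP[].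
have [x xK] : exists x, x \in K by apply/card_gt0P; rewrite cK; lia.
have sL : s \notin leaves.
  by have [xL sx] := KL x xK; apply: (leaf_nbr_notin D2 xL sD); rewrite e_sym.
have cH := cardH; set H := D :\: leaves in cH *.
have sH : s \in H by rewrite inE sL.
have [|x0 x0A good] := good_vertex bf _ cA.
  by rewrite -card_gt0; apply: leq_trans DA; apply: leq_trans D2.
have [|||S sS SH nS||f1 [emb1 im1 f1E]] :=
  @greedy_embedding R T e e_sym e_irr A [set s] H (fun=> x0) d.+1 k.-1 _ _ _ A_sparse.
- by rewrite sub1set.
- by split=> u v; rewrite !inE => /eqP-> /eqP-> //; rewrite e_irr.
- by apply/subsetP=> z /imsetP[u _ ->].
- have sSs : s \in S by rewrite -sub1set.
  have [||u [uS du _]] := degenerate e_sym e_irr D_conn D_sum hd (S := S :\ s).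
  + by apply: subset_trans (subsetDl _ _) (subset_trans SH (subsetDl _ _)).
  + by apply: contraNneq nS => E; rewrite -(setD1K sSs) E setU0.
  (* The vertex [s] is placed in advance and may be one more neighbour of [u], hence the bound
     [d + 1]. *)
  exists u => //; rewrite -(setD1K sSs) degU1 ?setD11 //.
  by move: du; case: (e u s); clear; lia.
- by move: cH DA cL; clear; lia.
have KD : K \subset D by apply/subsetP=> v /KL[/(subsetP LD)].
have HD0 : H \subset D :\: K.
  apply/subsetP=> v; rewrite !inE => /andP[vL vD]; rewrite vD andbT.
  by apply: contra vL => /KL[]; rewrite inE.
have [S sS SD nS||f2 [emb2 im2 f2E]] :=
  @greedy_embedding R T e e_sym e_irr A H (D :\: K) f1 1 k.-1 HD0 emb1 im1 A_sparse.
- have /subsetPn[u uS uH] : ~~ (S \subset H).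
    by apply: contra nS => SsH; rewrite eqEsubset SsH.
  have uD : u \in D by have := subsetP SD u uS; rewrite inE => /andP[].
  exists u; first by rewrite inE uH.
  have : u \in leaves by move: uH; rewrite inE uD andbT negbK.
  rewrite inE => /andP[_ /eqP <-]; apply: deg_mono.
  exact: subset_trans SD (subsetDl _ _).
- by have := cardsID K D; rewrite (setIidPr KD) cK; move: DA; clear; lia.
have f2s : f2 s = x0 by rewrite f2E // f1E ?inE.
have sD0 : s \in D :\: K := subsetP HD0 s sH.
have cD0 : #|D :\: K| + k.-1 = #|D|.
  by have := cardsID K D; rewrite (setIidPr KD) cK addnC.
have DE : D = (D :\: K) :|: K.
  by apply/setP=> v; rewrite !inE; case: (boolP (v \in K)) => [/(subsetP KD)->|_]; rewrite ?orbT ?orbF.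
(* Either [s] sits on a vertex red to all the rest of [A], where at least [k - 1] vertices are still
   free, or the red neighbours outside [A] are taken. *)
have [Z hZ cZ] : exists2 Z : {set R}, (forall z, z \in Z -> sedge (f2 s) z /\ z \notin f2 @: (D :\: K)) & k.-1 <= #|Z|.
  case: good => [full|many].
    exists (A :\: f2 @: (D :\: K)).
      move=> z; rewrite inE => /andP[zf zA]; split=> //.
      have := full z zA; rewrite /blue /compl_rel f2s negb_and !negbK => /orP[/eqP x0z|//].
      by rewrite -x0z -f2s imset_f in zf.
    have := cardsID (f2 @: (D :\: K)) A; rewrite (setIidPr im2).
    have := leq_imset_card f2 (D :\: K).
    by move: cD0 DA; rewrite -[#|_ @: _|]/(#|f2 @: (D :\: K)|); clear; lia.
  exists [set y in ~: A | sedge x0 y] => // z; rewrite !inE f2s => /andP[zA ->]; split=> //.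
  by apply: contra zA; apply: (subsetP im2).
rewrite DE; apply: (star_extension emb2 sD0 _ _ hZ); last by rewrite cK.
- by rewrite disjoint_sym disjoints_subset; apply/subsetP=> v vK; rewrite !inE vK.
- move=> v w vK; rewrite -DE => wD vw; have [vL sv] := KL v vK.
  by apply: leaf_nbr vL sD wD _ vw; rewrite e_sym.
Qed.

(** If a leaf [x] with neighbour [h] is blocked, every free vertex of [A] is blue to [f h], so at
    most [k - 1] are free and more than [(k - 1) ^ 2] leaves are already placed. At most
    [(k - 1) ^ 2] of these are unfit for an exchange. *)
Lemma embed_spread : (forall s, s \in D -> #|[set x in leaves | e s x]| < k.-1) ->
  d * k.-1 <= #|leaves| -> k * k.-1 < #|leaves| ->
  exists f : T -> R, partial_emb e D f.
Proof.
move=> few cL cL'; have cH := cardH; set H := D :\: leaves in cH *.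
have HD : H \subset D by apply: subsetDl.
have [|fH [embH imH]] := greedy_in_nbhd A_sparse HD; first by move: cH DA cL; clear; lia.
suff main j (L' : {set T}) : L' \subset leaves -> #|L'| = j ->
    exists f : T -> R, partial_emb e (H :|: L') f /\ f @: (H :|: L') \subset A.
  have [f [femb _]] := main _ leaves (subxx _) erefl; exists f.
  suff -> : D = H :|: leaves by [].
  by rewrite setUC -{1}(setIidPr LD) setID.
elim: j L' => [|j IH] L' sL' cL1.
  by exists fH; rewrite (cards0_eq cL1) setU0.
have [x xL'] : exists x, x \in L' by apply/card_gt0P; rewrite cL1.
have xL : x \in leaves := subsetP sL' x xL'.
have cL2 : #|L' :\ x| = j by move: cL1; rewrite (cardsD1 x L') xL' => -[].
have sL2 : L' :\ x \subset leaves by apply: subset_trans (subsetDl _ _) sL'.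
have [f [femb fA]] := IH (L' :\ x) sL2 cL2.
set S := H :|: L' :\ x in femb fA *.
have SE : H :|: L' = x |: S by rewrite setUCA setD1K.
have xS : x \notin S by rewrite in_setU in_setD1 eqxx in_setD xL.
have SD : S \subset D by rewrite subUset HD (subset_trans sL2 LD).
have cS : #|S| = #|H| + j.
  rewrite cardsU cL2 (_ : H :&: (L' :\ x) = set0) ?cards0 ?subn0 //.
  apply/setP=> u; rewrite in_set0 in_setI.
  apply/negbTE/negP=> /andP[/setDP[_ uL] /setD1P[_ /(subsetP sL')]].
  by rewrite (negPf uL).
have par u : u \in leaves -> exists2 h, h \in H & e u h.
  move=> uL; have [h hD uh] := leaf_has_nbr uL; exists h => //.
  by rewrite inE hD andbT (leaf_nbr_notin D2 uL).
have onlypar u h w : u \in leaves -> h \in H -> w \in S -> e u h -> e u w -> w = h.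
  move=> uL hH wS uh uw; apply: (leaf_nbr uL _ _ uh uw); last exact: (subsetP SD).
  exact: (subsetP HD).
have inH u : u \in H -> u \in S by move=> uH; rewrite inE uH.
have [h hH xh] := par x xL.
have fhA : f h \in A by apply: (subsetP fA); rewrite imset_f ?inH.
have cj : j < #|leaves| by rewrite -cL1 subset_leq_card.
have cfS : #|f @: S| = #|S| by rewrite card_in_imset //; apply: femb.1.
have cfree : #|A :\: f @: S| + #|S| = #|A|.
  by have := cardsID (f @: S) A; rewrite (setIidPr fA) cfS addnC.
have extend (y : R) : y \in A -> y \notin f @: S -> sedge (f h) y ->
    exists f' : T -> R, partial_emb e (H :|: L') f' /\ f' @: (H :|: L') \subset A.
  move=> yA yf hy; exists [eta f with x |-> y]; rewrite SE; split.
    by apply: partial_emb_extend => // w wS xw; rewrite (onlypar x h w).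
  apply/subsetP=> z /imsetP[u uS ->] /=; case: eqP => // /eqP ux.
  by apply: (subsetP fA); rewrite imset_f //; move: uS; rewrite !inE (negPf ux).
have [/existsP[y /and3P[yA yf hy]]|/existsPn blocked] :=
    boolP [exists y, [&& y \in A, y \notin f @: S & sedge (f h) y]]; first exact: extend hy.
have blue_free y : y \in A -> y \notin f @: S -> blue (f h) y.
  move=> yA yf; have := blocked y; rewrite yA yf /= /blue /compl_rel => ->.
  by rewrite andbT; apply: contraNneq yf => <-; rewrite imset_f ?inH.
have cfree' : #|A :\: f @: S| <= k.-1.
  apply: leq_trans (A_sparse fhA); apply/subset_leq_card/subsetP=> y.
  by rewrite !inE => /andP[yf yA]; rewrite yA blue_free.
have [y] : exists y, y \in A :\: f @: S by apply/card_gt0P; move: cfree cS cH DA cj; clear; lia.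
rewrite inE => /andP[yf yA].
(* [B1] holds the placed leaves whose image cannot be handed to [x]; [B2] covers the leaves that
   cannot move to [y]. *)
pose B1 := [set u in L' :\ x | blue (f h) (f u)].
pose B2 := \bigcup_(w in [set w in H | blue (f w) y]) [set u in leaves | e w u].
have cB1 : #|B1| <= k.-1.
  rewrite -(card_in_imset (f := f)); last first.
    by move=> u v /setIdP[uL _] /setIdP[vL _]; apply: femb.1; rewrite inE ?uL ?vL orbT.
  apply: leq_trans (A_sparse fhA); apply/subset_leq_card/subsetP=> z /imsetP[u /setIdP[uL bu] ->].
  by rewrite inE bu andbT (subsetP fA) // imset_f // inE uL orbT.
have cB2 : #|B2| <= k.-1 * k.-2.
  apply: leq_trans (card_bigcup_leq _ _) _.
  apply: (@leq_trans (\sum_(w in [set w in H | blue (f w) y]) k.-2)).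
    apply: leq_sum => w; rewrite inE => /andP[wH _].
    by have := few w (subsetP HD w wH); clear; lia.
  rewrite sum_nat_const leq_mul2r; apply/orP; right.
  rewrite -(card_in_imset (f := f)); last first.
    by move=> u v /setIdP[uH _] /setIdP[vH _]; apply: femb.1; apply: inH.
  apply: leq_trans (A_sparse yA); apply/subset_leq_card/subsetP=> z /imsetP[u /setIdP[uH bu] ->].
  have yu : blue y (f u) by rewrite /blue compl_rel_sym.
  by rewrite inE yu andbT (subsetP fA) // imset_f // inH.
have [u uL' uB] : exists2 u, u \in L' :\ x & u \notin B1 :|: B2.
  apply/subsetPn; apply: contraTN isT => /subset_leq_card.
  have := (leq_card_setU B1 B2).1.
  have : k.-1 + k.-1 * k.-2 = k.-1 * k.-1 by case: k k2 => [|[|m]] //= _; rewrite mulnS.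
  have : k * k.-1 = k.-1 * k.-1 + k.-1 by case: k k2 => [|m] //= _; rewrite mulSn addnC.
  by move: cB1 cB2 cfree cfree' cS cH DA cL'; rewrite cL2; clear; lia.
have uL := subsetP sL2 u uL'.
have uS : u \in S by rewrite inE uL' orbT.
have [h' h'H uh'] := par u uL.
move: uB; rewrite in_setU negb_or => /andP[uB1 uB2].
have ux : u != x by case/setD1P: uL'.
have hu : h != u by apply: contraTneq hH => ->; apply/negP=> /setDP[_]; rewrite uL.
have red_hu : sedge (f h) (f u).
  move: uB1; rewrite inE uL' /= /blue /compl_rel negb_and !negbK => /orP[/eqP fhu|//].
  by move: hu; rewrite (femb.1 h u (inH h hH) uS fhu) eqxx.
have red_h'y : sedge (f h') y.
  apply: contraNT uB2 => nr; apply/bigcupP; exists h'; last by rewrite inE uL e_sym.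
  rewrite inE h'H /blue /compl_rel nr andbT.
  by apply: contraNneq yf => <-; rewrite imset_f ?inH.
(* Swap: [u] moves to the free vertex [y], and [x] takes the place of [u]. *)
have emb1 : partial_emb e S [eta f with u |-> y].
  rewrite -{1}(setD1K uS); apply: partial_emb_extend; rewrite ?setD11 //.
  - by apply: partial_emb_sub femb; apply: subsetDl.
  - by apply: contra yf; apply/subsetP/imsetS/subsetDl.
  - by move=> w; rewrite inE => /andP[_ wS] uw; rewrite (onlypar u h' w).
exists [eta [eta f with u |-> y] with x |-> f u]; rewrite SE; split.
  apply: partial_emb_extend => //.
    apply/negP=> /imsetP[w wS] /=; case: eqP => [_ fuy|/eqP wu fuw].
      by rewrite -fuy imset_f in yf.
    by move: wu; rewrite (femb.1 u w uS wS fuw) eqxx.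
  by move=> w wS xw; rewrite (onlypar x h w) //= (negPf hu).
apply/subsetP=> z /imsetP[w wS ->] /=; case: eqP => [_|/eqP wx].
  by apply: (subsetP fA); rewrite imset_f.
case: eqP => // _; apply: (subsetP fA); rewrite imset_f //.
by move: wS; rewrite in_setU1 (negPf wx).
Qed.

End Embedding.

(** * Numerical estimates *)

(** The least admissible [d] is taken: [l + 2] is admissible, and failure of [d - 1] bounds the
    square. *)
Lemma degeneracy_bound l : exists d,
  [/\ 2 * l < d.-1 * d.+2, d <= l + 2 & d * d <= 3 * l + 4].
Proof.
have ex : exists d, 2 * l < d.-1 * d.+2 by exists (l + 2); rewrite addn2 /=; nia.
case: (ex_minnP ex) => d hd dmin; exists d.
case: d hd dmin => [|[|c]] // hd dmin.
have : ~~ (2 * l < c * c.+3) by apply/negP=> /(dmin c.+1); rewrite ltnn.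
by rewrite -leqNgt => h; split=> //; nia.
Qed.

(** The bound on [m] is the vertex count for no leaves and [r = 3 * k + 2]. All terms are of order
    [l * k] or [k], where [181 * l * k <= n] and [34 * k <= n]. *)
Lemma small_core_arith k n l d m : 0 < k -> 34 * k ^ 3 <= n ->
  l * (119 * k ^ 2 + 62 * k) <= n -> d * d <= 3 * l + 4 ->
  m <= 6 * l * (3 * k + 2) + 2 * l + (3 * k + 2) ->
  3 * m + 2 * l + d * (d * k.-1) <= 2 * n - 1.
Proof.
move=> k0 hn hl hd hm; set a := l * k; set dk := d * (d * k.-1).
have h1 : 181 * a <= n.
  apply: leq_trans hl; have : a <= a * k by rewrite leq_pmulr.
  by rewrite /a -mulnn; clear; lia.
have h2 : 34 * k <= n by apply: leq_trans hn; rewrite leq_mul2l /= -{1}(expn1 k) leq_pexp2l.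
have h3 : l <= a by rewrite leq_pmulr.
have h4 : dk <= 3 * a + 4 * k.
  rewrite /dk mulnA; apply: (@leq_trans ((3 * l + 4) * k)).
    by apply: leq_mul => //; apply: leq_pred.
  by rewrite /a; clear; lia.
have h5 : m <= 18 * a + 14 * l + 3 * k + 2 by move: hm; rewrite /a; clear; lia.
by move: h1 h2 h3 h4 h5 k0; clear; lia.
Qed.

(** As [m] is nearly [n], the vertex count makes [p * (12 * k + 10)] nearly [n]. If [p] were below
    either bound, this product would be at most about [12 * l * k ^ 2 + 36 * k ^ 2] or [12 * k ^ 3],
    too small for the assumptions on [n]. *)
Lemma many_leaves_arith k n l d m p : 1 < k -> 34 * k ^ 3 <= n ->
  l * (119 * k ^ 2 + 62 * k) <= n -> d <= l + 2 -> n < m + d * k.-1 ->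
  m <= (4 * p + 6 * l) * (3 * k + 2) + 2 * p + 2 * l + (3 * k + 2) ->
  [/\ d.+1 * k.-1 <= p, k * k.-1 < p & 2 < m].
Proof.
move=> k1 hn hl hd hnm hm.
set b := l * k * k; set a := l * k; set q := k * k; set c := k ^ 3 in hn.
set dk := d * k.-1 in hnm.
have h1 : 119 * b + 62 * a <= n.
  by apply: leq_trans hl; rewrite /a /b -mulnn; clear; lia.
have h2 : 2 * a <= b by rewrite mulnC leq_mul2l k1 orbT.
have h3 : 2 * l <= a by rewrite mulnC leq_mul2l k1 orbT.
have cE : c = q * k by rewrite /c /q !expnS expn0 muln1 mulnA.
have h4 : 2 * q <= c by rewrite cE mulnC leq_mul2l k1 orbT.
have h5 : 2 * k <= q by rewrite leq_mul2r k1 orbT.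
have h6 : dk + l + 2 <= a + 2 * k.
  have : dk <= (l + 2) * k.-1 by rewrite leq_mul2r hd orbT.
  by rewrite /a -{2 3}(prednK (ltnW k1)); clear; lia.
set pk := p * (12 * k + 10).
have h7 : n + 1 <= pk + 19 * a + 13 * l + 5 * k.
  by move: hnm hm h6; rewrite /pk /a; clear; lia.
split.
- rewrite leqNgt; apply/negP; rewrite mulSn -/dk => hp.
  have h8 : p + 4 <= a + 3 * k by move: hp h6 k1; clear; lia.
  have h9 : (p + 4) * (12 * k + 10) <= (a + 3 * k) * (12 * k + 10) by rewrite leq_mul2r h8 orbT.
  have h10 : pk + 48 * k + 40 <= 12 * b + 10 * a + 36 * q + 30 * k.
    by move: h9; rewrite /pk /b /q -/a; clear; lia.
  by move: h1 h2 h3 h4 h5 h7 h10 hn; clear; lia.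
- rewrite ltnNge; apply/negP=> hp.
  have h8 : pk <= (k * k.-1) * (12 * k + 10) by rewrite leq_mul2r hp orbT.
  have h9 : (k * k.-1) * (12 * k + 10) + 2 * q + 10 * k = 12 * c.
    by rewrite cE /q -[k in RHS](prednK (ltnW k1)) -{1 3 4 5 6}(prednK (ltnW k1)); clear; lia.
  by move: h1 h2 h3 h4 h5 h7 h8 h9 hn k1; clear; lia.
- by move: h1 h2 h3 h4 h5 h6 hnm hn k1; clear; lia.
Qed.

(** * The induction embedding the guest into a host on [2 * n - 1] vertices *)

Lemma long_suspended_dec (T : finType) (e : rel T) (D : {set T}) r :
  (exists2 s, suspended e D s & size s = r) \/
  (forall s, suspended e D s -> size s != r).
Proof.
pose P (t : r.-tuple T) := [&& uniq t, sorted e t & all (mem (degree_two e D)) t].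
have [/existsP[t /and3P[ut st /allP at_]]|/existsPn no] := boolP [exists t, P t].
  by left; exists t; [split | rewrite size_tuple].
right=> s [us ss sD]; apply/negP=> sz; have := no (Tuple sz).
by rewrite /P us ss /=; case/negP; apply/allP.
Qed.

Section SparseEmbedding.
Variables (R : sgraph) (k n l : nat) (T : finType) (f0 : T -> R).
Hypotheses (bf : book_free k R) (cR : #|R| = 2 * n - 1).
Hypotheses (k0 : 0 < k) (hn : 34 * k ^ 3 <= n) (hl : l * (119 * k ^ 2 + 62 * k) <= n).

(** The relation [e] varies in the induction because shortening adds an edge, while [l] and [n] stay
    fixed; hence [#|D| <= n] instead of equality. *)
Lemma sparse_embedding (e : rel T) (D : {set T}) : symmetric e -> irreflexive e ->
  connected_on e D -> degsum e D <= 2 * #|D| + 2 * l -> #|D| <= n ->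
  exists f : T -> R, partial_emb e D f.
Proof.
have [j] := ubnP #|D|; elim: j e D => // j IH e D hj es ei cD dD Dn.
have k34 : 34 * k <= n.
  by apply: leq_trans hn; rewrite leq_mul2l /= -{1}(expn1 k) leq_pexp2l.
have [[s sus szs]|nolong] := long_suspended_dec e D (3 * k + 3).
  have [x0 [x1 [x2 [s' sE]]]] : exists x0 x1 x2 s', s = [:: x0, x1, x2 & s'].
    case: s szs {sus} => [|x0 [|x1 [|x2 s']]] /= szs; try lia.
    by exists x0, x1, x2, s'.
  have [us ss sD2] := sus.
  have xD x : x \in s -> x \in degree_two e D by apply: sD2.
  have [d0 d1 d2] : [/\ x0 \in degree_two e D, x1 \in degree_two e D & x2 \in degree_two e D].
    by split; apply: xD; rewrite sE !inE eqxx ?orbT.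
  have inD x : x \in degree_two e D -> x \in D by rewrite inE => /andP[].
  have [x02 e01 e12] : [/\ x0 != x2, e x0 x1 & e x1 x2].
    move: us ss; rewrite sE /= !inE !negb_or => /andP[/and3P[_ -> _] _].
    by case/and3P.
  have x1E v : v \in D -> e x1 v = (v == x0) || (v == x2).
    move=> vD; apply: (degree_two_nbrs d1) => //; first exact: inD.
    - exact: inD.
    - by rewrite es.
  have cD1 : #|D| = #|D :\ x1|.+1 by rewrite (cardsD1 x1) (inD _ d1).
  have [||||||f femb] := IH (add_edge e x0 x2) (D :\ x1).
  - by rewrite -cD1.
  - exact: add_edge_sym.
  - exact: add_edge_irr.
  - by apply: connected_on_shorten; rewrite ?inD.
  - have := degsum_shorten es ei (inD _ d0) (inD _ d1) (inD _ d2) x02 x1E.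
    by move: dD; rewrite cD1; clear; lia.
  - by apply: ltnW; rewrite -cD1.
  apply: (unshorten es ei bf sE sus szs femb).
  (* The shortened guest occupies at most [n - 1] vertices, so at least [n] lie outside its
     image. *)
  have := cardsC (f @: (D :\ x1)); have := leq_imset_card f (D :\ x1).
  by rewrite cR; move: Dn cD1; clear; lia.
have [d [hd dl dd]] := degeneracy_bound l.
have count : #|D| <= (4 * #|leaves e D| + 6 * l) * (3 * k + 2) + 2 * #|leaves e D|
    + 2 * l + (3 * k + 2).
  apply: (card_no_long_suspended es cD dD); first by rewrite addn2.
  by move=> s /nolong; rewrite addnS.
have [/existsP[v hv]|/existsPn hv] := boolP [exists v : R, n <= #|[set y | compl_rel v y]|].
  (* Exactly [n] vertices are kept, so that the [n - 1] others provide the [3 * k] vertices needed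
     outside [A]. *)
  have [A sA cA] := exists_subset_card hv.
  have A_sparse := fun x => @blue_deg_nbhd R k bf A v x sA.
  have [c1|c1] := leqP (#|D| + d * k.-1) n.
    rewrite -cA in c1; have [f [femb _]] := greedy_in_nbhd es ei f0 cD dD hd A_sparse (subxx _) c1.
    by exists f.
  (* For [k = 1] the greedy bound reduces to [#|D| <= n], which holds. *)
  have k1 : 1 < k.
    rewrite ltn_neqAle k0 andbT; apply/negP=> /eqP k1.
    by move: c1; rewrite -k1 muln0 addn0 ltnNge Dn.
  have [p1 p2 D2] := many_leaves_arith k1 hn hl dl c1 count.
  rewrite -cA in Dn.
  have [/existsP[s /andP[sD hs]]|/existsPn hs] :=
      boolP [exists s, (s \in D) && (k.-1 <= #|[set x in leaves e D | e s x]|)].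
    apply: (embed_hub bf es ei cD dD hd A_sparse Dn D2 k1 sD hs p1).
    by have := cardsC A; rewrite cA cR; move: k34 k0; clear; lia.
  apply: (embed_spread es ei f0 cD dD hd A_sparse Dn D2 k1) => //.
    by move=> s sD; have := hs s; rewrite sD /= -ltnNge.
  by move: p1; rewrite mulSn; clear; lia.
have [/existsP[u uL]|/existsPn noL] := boolP [exists u, u \in leaves e D].
  have [uD /eqP du] : u \in D /\ deg e D u == 1 by move: uL; rewrite inE => /andP[].
  have cD1 : #|D| = #|D :\ u|.+1 by rewrite (cardsD1 u) uD.
  have [||||f femb] := IH e (D :\ u) _ es ei.
  - by rewrite -cD1.
  - exact: connected_on_remove_leaf.
  - by move: dD; rewrite (degsumD1 es ei uD) du cD1; clear; lia.
  - by apply: ltnW; rewrite -cD1.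
  (* At most [n - 1] vertices are used and at most [n - 1] are blue to the image of the leaf's
     neighbour, which leaves one of [2 * n - 1]. *)
  have [w wS ew||y [_ yf hy]] := @free_vertex R T e (D :\ u) f u setT n.-1.
  - rewrite -ltnS prednK; last by move: k34 k0; clear; lia.
    have := hv (f w); rewrite -ltnNge; apply: leq_ltn_trans.
    by apply/subset_leq_card/subsetP=> y; rewrite !inE.
  - have : deg e (D :\ u) u * n.-1 <= 1 * n.-1.
      by rewrite leq_mul2r; apply/orP; right; rewrite -du; apply: deg_mono (subsetDl _ _).
    have := leq_imset_card f (D :\ u).
    by rewrite setTI cardsT cR; move: Dn k34 k0; rewrite cD1; clear; lia.
  exists [eta f with u |-> y]; rewrite -(setD1K uD).
  by apply: partial_emb_extend; rewrite ?setD11.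
have L0 : #|leaves e D| = 0 by apply/eqP; rewrite cards_eq0; apply/eqP/setP=> u; rewrite in_set0 (negPf (noL u)).
apply: (embed_small bf es ei f0 cD dD hd); rewrite cR.
apply: (small_core_arith k0 hn hl dd); move: count; rewrite L0; clear; lia.
Qed.

End SparseEmbedding.

(** * From graphs and colourings to the embedding statement, and the lower bound *)

Lemma connected_on_setT (G : sgraph) : connected_graph G ->
  connected_on (@sedge G) [set: G].
Proof.
move=> [_ cG] S _ /set0Pn[u uS] SnT.
have /subsetPn[v _ vS] : ~~ ([set: G] \subset S) by rewrite subTset.
have /connectP[p] := cG u v; elim: p u uS => [|w p IH] u uS /=.
  by move=> _ vu; rewrite vu uS in vS.
case/andP=> uw pp vE; have [wS|wS] := boolP (w \in S); first exact: IH wS pp vE.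
by exists u, w; rewrite !inE wS.
Qed.

(** The degree sum counts ordered adjacent pairs, and at most two of them yield the same edge. *)
Lemma degsum_edge_set (G : sgraph) : degsum (@sedge G) [set: G] <= 2 * #|edge_set G|.
Proof.
pose P := [set uv : G * G | sedge uv.1 uv.2].
have -> : degsum (@sedge G) [set: G] = #|P|.
  rewrite /degsum /deg -sum1_card; under eq_bigr do rewrite -sum1_card.
  rewrite pair_big_dep /=; apply: eq_bigl => -[u v] /=; by rewrite !inE.
pose g (uv : G * G) := [set uv.1; uv.2].
have gP uv : uv \in P -> g uv \in edge_set G.
  rewrite !inE => h; apply/existsP; exists uv.1; apply/existsP; exists uv.2.
  by rewrite h eqxx.
rewrite -sum1_card (partition_big g (mem (edge_set G))) //= mulnC -sum_nat_const.
apply: leq_sum => E; rewrite inE => /existsP[x /existsP[y /andP[xy /eqP ->]]].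
rewrite sum1_card.
apply: (@leq_trans #|[set (x, y); (y, x)]|); last by rewrite cards2; case: (_ != _).
apply/subset_leq_card/subsetP=> -[u v]; rewrite !inE => /andP[uv /eqP].
rewrite /g /= => uvE; rewrite inE /= in uv.
have unv : u != v by apply: contraTneq uv => ->; rewrite sedge_irr.
have hu : u \in [set x; y] by rewrite -uvE set21.
have hv : v \in [set x; y] by rewrite -uvE set22.
move: hu hv unv; rewrite !in_set2 !xpair_eqE => /orP[]/eqP-> /orP[]/eqP->;
by rewrite ?eqxx ?orbT.
Qed.

Lemma blue_book N (c : {set 'I_N} -> bool) k (x y : colour_class c true) :
  compl_rel x y -> k <= #|[set z | compl_rel x z && compl_rel y z]| ->
  contains_copy (colour_class c false) (book k).
Proof.
move=> xy hk; set Z := [set z | compl_rel x z && compl_rel y z] in hk.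
have blueE (a b : colour_class c true) : @compl_rel (colour_class c true) a b -> @colour_rel N c false a b.
  rewrite /compl_rel /= /colour_rel /= /complete_rel => /andP[->] /=.
  by rewrite eqb_id eqbF_neg.
have szZ : k <= size (enum Z) by rewrite -cardE.
pose f (u : 'I_2 + 'I_k) : 'I_N := match u with
  | inl i => if i == ord0 then x else y
  | inr i => nth x (enum Z) i
  end.
have fZ (i : 'I_k) : f (inr i) \in Z.
  by rewrite -mem_enum mem_nth // (leq_trans (ltn_ord i)).
have fi i (j : 'I_k) : @compl_rel (colour_class c true) (f (inl i)) (f (inr j)).
  by have := fZ j; rewrite inE => /andP[h1 h2] /=; case: (_ == _).
have o2 (i j : 'I_2) : i != ord0 -> j != ord0 -> i = j.
  by case: i => [[|[|]]] // ? ; case: j => [[|[|]]] // ? _ _; apply: val_inj.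
have blue_sym (a b : colour_class c true) : compl_rel a b -> compl_rel b a by rewrite compl_rel_sym.
exists f; split.
- have ne (a b : colour_class c true) : compl_rel a b -> a <> b by case/andP=> /eqP.
  move=> [i|i] [j|j].
  + rewrite /f; case: (i =P ord0) => [->|/eqP i0]; case: (j =P ord0) => [->|/eqP j0] //.
    * by move/(ne _ _ xy).
    * by move/esym/(ne _ _ xy).
    * by rewrite (o2 i j).
  + by move/(ne _ _ (fi i j)).
  + by move/esym/(ne _ _ (fi j i)).
  + move=> /eqP; rewrite /f nth_uniq ?enum_uniq ?(leq_trans (ltn_ord _)) //.
    by move/eqP/val_inj->.
- move=> [i|i] [j|j] /=.
  + rewrite /complete_rel => ij; apply: blueE; rewrite /f.
    case: (i =P ord0) ij => [->|/eqP i0]; case: (j =P ord0) => [->|/eqP j0] //= ij.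
    * exact: blue_sym.
    * by move: ij; rewrite (o2 _ _ i0 j0) eqxx.
  + by move=> _; apply: blueE; apply: (fi i j).
  + by move=> _; apply: blueE; apply: blue_sym; apply: (fi j i).
  + by rewrite /compl_rel /= /complete_rel andbN.
Qed.

Lemma card_ord_interval M (A : {set 'I_M}) a b :
  (forall i : 'I_M, i \in A -> a <= i < a + b) -> #|A| <= b.
Proof.
move=> hA; rewrite cardE -(size_map val) -(size_iota a b); apply: uniq_leq_size.
  by rewrite map_inj_uniq ?enum_uniq //; apply: val_inj.
by move=> z /mapP[i]; rewrite mem_enum => iA ->; rewrite mem_iota hA.
Qed.

(** Split at most [2 * n - 2] vertices into two parts of at most [n - 1], red inside and blue
    across. A connected red graph stays in one part, which is too small for [G], and the bipartite
    blue graph has no triangle, hence no book. *)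
Lemma arrows_lower_bound (G : sgraph) k n M : 0 < k -> connected_graph G -> #|G| = n ->
  0 < M -> arrows M G (book k) -> 2 * n - 1 <= M.
Proof.
move=> k0 cG cn M0 ar; rewrite leqNgt; apply/negP=> hM.
have n0 : 0 < n by rewrite -cn; case: cG.
pose low := [set i : 'I_M | i < n.-1].
have [[f [fi fe]]|[f [fi fe]]] := ar (fun E => (E \subset low) || (E \subset ~: low)).
- have side (x y : G) : (f x \in low) = (f y \in low).
    have /connectP[p] := cG.2 x y; elim: p x => [|z p IH] x /=; first by move=> _ ->.
    case/andP=> xz pp yE; rewrite -(IH z pp yE).
    have /andP[_] := fe x z xz; rewrite eqb_id => /orP[]/subsetP h.
      by rewrite !h ?inE ?eqxx ?orbT.
    have := h (f x); have := h (f z); rewrite !inE !eqxx !orbT.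
    by move=> /(_ isT)/negbTE -> /(_ isT)/negbTE ->.
  have cf : #|f @: [set: G]| = n by rewrite card_imset // cardsT.
  have [x0 _] : exists x, x \in [set: G] by apply/card_gt0P; rewrite cardsT cn.
  have [sub|sub] : f @: [set: G] \subset low \/ f @: [set: G] \subset ~: low.
    have [xl|xl] := boolP (f x0 \in low); [left | right]; apply/subsetP=> _ /imsetP[x _ ->].
      by rewrite (side x x0).
    by rewrite inE (side x x0).
  + have cl : #|low| <= n.-1 by apply: (@card_ord_interval _ _ 0) => i; rewrite inE.
    by have := leq_trans (subset_leq_card sub) cl; rewrite cf; move: n0; clear; lia.
  + have cl : #|~: low| <= n.-1.
      apply: (@card_ord_interval _ _ n.-1) => i; rewrite !inE -leqNgt => ->.
      by apply: leq_trans (ltn_ord i) _; move: hM n0; clear; lia.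
    by have := leq_trans (subset_leq_card sub) cl; rewrite cf; move: n0; clear; lia.
- have diff u v : colour_rel (fun E => (E \subset low) || (E \subset ~: low)) false u v -> (u \in low) != (v \in low).
    case/andP=> _; apply: contraTneq => uv; rewrite eqbF_neg negbK.
    have [ul|ul] := boolP (u \in low); apply/orP; [left | right].
      by apply/subsetP=> w; rewrite !in_set2 => /orP[]/eqP->; rewrite -?uv.
    by apply/subsetP=> w; rewrite !in_set2 => /orP[]/eqP->; rewrite in_setC -?uv.
  have := diff _ _ (fe (inl ord0) (inl (lift ord0 ord0)) isT).
  have := diff _ _ (fe (inl ord0) (inr (Ordinal k0)) isT).
  have := diff _ _ (fe (inl (lift ord0 ord0)) (inr (Ordinal k0)) isT).
  by do 3!case: (_ \in low).
Qed.

Import Order.TTheory GRing.Theory Num.Theory.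

Theorem theorem1p8 (k n : nat) (hk : 0 < k) (hn : 34 * k ^ 3 <= n)
    (G : sgraph) (hconn : connected_graph G) (hcard : #|G| = n)
    (hedges : ((#|edge_set G|%:R : rat) <=
               n%:R * (1 + 1 / (119%:R * k%:R ^+ 2 + 62%:R * k%:R)))%R) :
  is_ramsey_number G (book k) (2 * n - 1).
Proof.
have n0 : 0 < n by rewrite -hcard; case: hconn.
(* The subtraction is truncated, so [l = 0] for a tree. Clearing denominators turns the edge bound
   into [hl]. *)
set l := #|edge_set G| - n.
have hl : l * (119 * k ^ 2 + 62 * k) <= n.
  have [h|h] := leqP #|edge_set G| n; first by rewrite /l (eqP h) mul0n.
  set q := 119 * k ^ 2 + 62 * k.
  have q0 : 0 < q by rewrite addn_gt0 !muln_gt0 hk orbT.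
  have qE : (119%:R * k%:R ^+ 2 + 62%:R * k%:R = q%:R :> rat)%R.
    by rewrite natrD (natrM _ 119) (natrM _ 62) natrX.
  rewrite qE in hedges; clearbody q.
  have qpos : (0 < q%:R :> rat)%R by rewrite ltr0n.
  have : ((#|edge_set G| * q)%:R <= (n * q + n)%:R :> rat)%R.
    rewrite natrD (natrM _ n) natrM; apply: (@le_trans _ _ (n%:R * (1 + 1 / q%:R) * q%:R)%R).
      by rewrite ler_pM2r.
    by rewrite mulrDr mulr1 mulrDl mulrA mulr1 mulfVK ?gt_eqF.
  by rewrite ler_nat /l mulnBl leq_subLR.
split; first by lia.
- move=> c.
  have [/existsP[x /existsP[y /andP[xy hxy]]]|/existsPn nb] := boolP [exists x : colour_class c true,
      exists y : colour_class c true, compl_rel x y && (k <= #|[set z | compl_rel x z && compl_rel y z]|)].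
    by right; apply: blue_book hxy.
  have bf : book_free k (colour_class c true).
    by move=> x y xy; have /existsPn/(_ y) := nb x; rewrite xy /= -ltnNge.
  have N0 : 0 < 2 * n - 1 by lia.
  (* The constant map only supplies a starting function for the embedding of the empty set. *)
  left; have [|||f [fi fe]] := sparse_embedding (fun=> Ordinal N0 : colour_class c true) bf _ hk hn hl
    (@sedge_sym G) (@sedge_irr G) (connected_on_setT hconn).
  + by rewrite card_ord.
  + by rewrite cardsT hcard; apply: leq_trans (degsum_edge_set G) _; rewrite /l; lia.
  + by rewrite cardsT hcard.
  by exists f; split=> [u v|u v]; [apply: fi | apply: fe]; rewrite inE.
- by move=> M M0 ar; apply: arrows_lower_bound ar.
Qed.
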